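(* Let $h\ge 2$ and $\kappa\ge 1$ be integers and let $\chi>1$ be real. Consider the class of all instances with capacity $C\ge h\cdot n_{\max}$, where $n_{\max}$ is the maximum number of instances demanded by a job, and with all job lengths in $[1,\kappa]$. On this class the competitive ratio of the greedy mechanism $\Gamma_G$ with the exponential priority function $f(\delta)=\chi^{\delta}$ is exactly $$\frac{h}{h-1}\cdot\frac{\chi}{1-\chi^{-1/\kappa}}+1 .$$ That is, $\Gamma_G$ is $c$-competitive on this class for $c$ equal to this number, and it is not $c$-competitive on this class for any smaller $c$.
   Context: Setting. A cloud provider has $C\in\mathbb{N}$ identical instances at every time $t\in[0,\infty)$. A job sequence $\theta$ is a finite list of jobs $\theta_i=(r_i,d_i,n_i,l_i,v_i)$: release time $r_i\ge0$, deadline $d_i$, required number of instances $n_i$ (positive integer, $n_i\le n_{\max}\le C$), length $l_i\in[1,\kappa]$ ($\kappa$ a positive integer), value $v_i>0$. Nothing is known about job $i$ before time $r_i$. An allocation is feasible if at every time the total number of allocated instances is at most $C$. Job $i$ is completed if it receives at least $n_i$ instances continuously for $l_i$ time units between $r_i$ and $d_i$; an interrupted job loses all its progress but may be restarted from scratch. The social welfare of an allocation is the sum of the values of the completed jobs. $OPT(\theta)$ is the maximum social welfare of a feasible allocation computed offline with full knowledge of $\theta$; $W(M,\theta)$ is the social welfare obtained by the online mechanism $M$ on $\theta$ (with truthful reports). Competitiveness. $M$ is $c$-competitive on a class of instances if no instance in the class satisfies $c\cdot W(M,\theta)<OPT(\theta)$. The competitive ratio of $M$ on the class is the least such $c$ ($\infty$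 if there is none). Mechanism $\Gamma_G$ with priority function $f$ ($f:[0,1]\to\mathbb{R}$ non-decreasing, $f(0)=1$). At time $t$ let $\delta_i\in[0,1]$ be the fraction of $l_i$ for which job $i$ has been continuously processed up to $t$ in its current uninterrupted run ($\delta_i=0$ if it is not running). Job $i$ is feasible at $t$ if $r_i\le t$, $d_i-t\ge(1-\delta_i)l_i$, and it has not been completed. A time is critical if a job is released or a running job is completed at that time. At every critical time $t$, in increasing order: let $J_F$ be the set of feasible jobs; set $v_i'=v_if(\delta_i)$ and $\rho_i'=\frac{v_i}{n_i}f(\delta_i)$; number the jobs of $J_F$ by descending $\rho_i'$ (ties broken by an arbitrary fixed rule). If the total demand $\sum n_i$ of all jobs in $J_F$ is at most $C$, run all of $J_F$. Otherwise let $k$ be the smallest index with $n_1+\dots+n_k>C$; if $\sum_{i=1}^{k-1}v_i'\ge v_k'$ run jobs $1,\dots,k-1$, else run only job $k$. The chosen jobs run (job $i$ on $n_i$ instances) until the next critical time; running jobs that are not chosen are interrupted. (Each completed job pays its critical value, the minimum reported value for which it would be completed; payments do not affect social welfare.) *)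

(* Defs.v *)
From HB Require Import structures.
From mathcomp Require Import all_boot all_order all_algebra.
From mathcomp Require Import all_classical all_reals all_analysis.

Set Implicit Arguments.
Unset Strict Implicit.
Unset Printing Implicit Defensive.

Import Order.TTheory GRing.Theory Num.Theory.

Local Open Scope ring_scope.

Record job (R : realType) := Job {
  release : R;
  deadline : R;
  demand : nat;
  len : R;
  value : R }.

Record instance (R : realType) := Instance {
  capacity : nat;
  njobs : nat;
  jobs : 'I_njobs -> job R }.

(* The maximum of an empty family is 0. *)
Definition nmax (R : realType) (I : instance R) : nat :=
  (\max_(i < njobs I) demand (jobs i))%N.

(* Deadlines are unconstrained: a job with deadline < release + len is
   allowed, it just can never be completed. *)
Definition valid_job (R : realType) (kappa : nat) (j : job R) : Prop :=
  [/\ 0 <= release j, (0 < demand j)%N, 1 <= len j <= kappa%:R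
    & 0 < value j].

Definition instance_class (R : realType) (h kappa : nat) : set (instance R) :=
  [set I | (forall i, valid_job kappa (@jobs R I i)) /\
           (h * nmax I <= capacity I)%N].

(* [a i t] is the number of instances allocated to job i at time t. *)
Definition allocation (R : realType) (I : instance R) :=
  'I_(njobs I) -> R -> nat.

Definition feasible_alloc (R : realType) (I : instance R)
    (a : allocation I) : Prop :=
  forall t : R, 0 <= t -> (\sum_(i < njobs I) a i t <= capacity I)%N.

(* Processing intervals are half-open, so that a job may start at the very
   moment at which another one ends. *)
Definition completes (R : realType) (I : instance R) (a : allocation I)
    (i : 'I_(njobs I)) : Prop :=
  exists s : R,
    [/\ release (jobs i) <= s, s + len (jobs i) <= deadline (jobs i)
      & forall t : R, s <= t < s + len (jobs i) ->
          (demand (jobs i) <= a i t)%N].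

Definition social_welfare (R : realType) (I : instance R)
    (a : allocation I) : R :=
  \sum_(i < njobs I | `[< completes a i >]) value (jobs i).

Definition OPT (R : realType) (I : instance R) : R :=
  sup [set w | exists2 a : allocation I,
                 feasible_alloc a & w = social_welfare a]%classic.

(* The supremum in [OPT] is a maximum. *)
Lemma OPT_attained (R : realType) (I : instance R) :
  (exists2 a : allocation I, feasible_alloc a & OPT I = social_welfare a) /\
  (forall a : allocation I, feasible_alloc a -> social_welfare a <= OPT I).
Proof.
pose W (S : {set 'I_(njobs I)}) : R := \sum_(i in S) value (jobs i).
pose cs (a : allocation I) := [set i | `[< completes a i >]]%SET.
have WE a : social_welfare a = W (cs a).
  by apply: eq_bigl => i; rewrite inE.
pose P (S : {set 'I_(njobs I)}) :=
  `[< exists2 a : allocation I, feasible_alloc a & cs a = S >].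
have P0 : P (cs (fun _ _ => 0%N)).
  by apply/asboolP; exists (fun _ _ => 0%N) => // t _; rewrite big1.
case: (@Order.TotalTheory.arg_maxP _ R _ _ P W P0) => S /asboolP[a fa aS] Smax.
have ub (b : allocation I) : feasible_alloc b -> social_welfare b <= social_welfare a.
  move=> fb; rewrite !WE aS.
  by have /Smax : P (cs b) by apply/asboolP; exists b.
suff -> : OPT I = social_welfare a by split; [exists a | exact: ub].
apply/eqP; rewrite eq_le; apply/andP; split.
  by apply: ge_sup => [|_ [b fb ->]]; [exists (social_welfare a), a | exact: ub].
apply: ub_le_sup; last by exists a.
by exists (social_welfare a) => _ [b fb ->]; exact: ub.
Qed.

Definition competitive (R : realType) (W : instance R -> R)
    (K : set (instance R)) (c : R) : Prop :=
  ~ exists2 I, K I & c * W I < OPT I.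

Definition is_competitive_ratio (R : realType) (W : instance R -> R)
    (K : set (instance R)) (c : R) : Prop :=
  competitive W K c /\ forall c', c' < c -> ~ competitive W K c'.

(* State of the mechanism right after a critical time: [start i] is [Some u]
   when job i is running, its current uninterrupted run having begun at u. *)
Record state (R : realType) (n : nat) := State {
  now : R;
  start : 'I_n -> option R;
  finished : {set 'I_n} }.

(* A tie-breaking rule compares jobs through their position in the sequence,
   their parameters and their current progress; it is required to be a total
   preorder.  Jobs which it does not separate are ordered by position, [sort]
   being stable. *)
Definition tie_rule (R : realType) := rel (nat * job R * R).

(* Jobs completed at t must have been removed from [st]. *)
Definition progress (R : realType) (n : nat) (th : 'I_n -> job R)
    (st : 'I_n -> option R) (t : R) (i : 'I_n) : R :=
  if st i is Some u then (t - u) / len (th i) else 0.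

Definition feasible_job (R : realType) (n : nat) (th : 'I_n -> job R)
    (delta : 'I_n -> R) (fin : {set 'I_n}) (t : R) (i : 'I_n) : bool :=
  [&& release (th i) <= t,
      (1 - delta i) * len (th i) <= deadline (th i) - t
    & i \notin fin].

Definition vprio (R : realType) (f : R -> R) (n : nat) (th : 'I_n -> job R)
    (delta : 'I_n -> R) (i : 'I_n) : R :=
  value (th i) * f (delta i).

Definition rhoprio (R : realType) (f : R -> R) (n : nat) (th : 'I_n -> job R)
    (delta : 'I_n -> R) (i : 'I_n) : R :=
  value (th i) / (demand (th i))%:R * f (delta i).

Definition before (R : realType) (f : R -> R) (tie : tie_rule R) (n : nat)
    (th : 'I_n -> job R) (delta : 'I_n -> R) : rel 'I_n :=
  fun i j =>
    (rhoprio f th delta j < rhoprio f th delta i) ||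
    ((rhoprio f th delta i == rhoprio f th delta j) &&
     tie (val i, th i, delta i) (val j, th j, delta j)).

(* [k] is 0-based: [take k s] is the longest prefix of [s] that fits, and
   [take 1 (drop k s)] consists of the first job that does not. *)
Definition greedy_choice (R : realType) (C n : nat) (th : 'I_n -> job R)
    (v' : 'I_n -> R) (s : seq 'I_n) : seq 'I_n :=
  let dem (s' : seq 'I_n) := (\sum_(i <- s') demand (th i))%N in
  if (dem s <= C)%N then s else
  let k := find (fun m => C < dem (take m.+1 s))%N (iota 0 (size s)) in
  let fit := take k s in
  let blocked := take 1 (drop k s) in
  if \sum_(i <- blocked) v' i <= \sum_(i <- fit) v' i then fit else blocked.

(* What the mechanism does at the critical time t, coming from state s. *)
Definition act (R : realType) (f : R -> R) (tie : tie_rule R)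
    (I : instance R) (t : R) (s : state R (njobs I)) : state R (njobs I) :=
  let th := @jobs R I in
  let ends i := if start s i is Some u then u + len (th i) == t else false in
  let fin := finished s :|: [set i | ends i] in
  let st i := if ends i then None else start s i in
  let delta := progress th st t in
  let JF := sort (before f tie th delta)
                 [seq i <- enum 'I_(njobs I) | feasible_job th delta fin t i] in
  let chosen := greedy_choice (capacity I) th (vprio f th delta) JF in
  State t
    (fun i => if i \in chosen then Some (odflt t (st i)) else None) fin.

(* Future releases, and completions of the jobs now running. *)
Definition critical_times (R : realType) (I : instance R)
    (s : state R (njobs I)) : seq R :=
  [seq release (jobs i) | i <- enum 'I_(njobs I) & now s < release (jobs i)]
  ++ pmap (fun i => omap (fun u => u + len (jobs i)) (start s i))
          (enum 'I_(njobs I)).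

Definition step (R : realType) (f : R -> R) (tie : tie_rule R)
    (I : instance R) (s : state R (njobs I)) : state R (njobs I) :=
  if critical_times s is t :: ts then
    act f tie (foldr Order.min t ts) s
  else s.

(* Time -1 precedes every release, so time 0 may be critical. *)
Definition init (R : realType) (n : nat) : state R n :=
  State (-1) (fun=> None) finset.set0.

Definition gammaG_state (R : realType) (f : R -> R) (tie : tie_rule R)
    (I : instance R) (k : nat) : state R (njobs I) :=
  iter k (@step R f tie I) (init R (njobs I)).

Definition gammaG_welfare (R : realType) (f : R -> R) (tie : tie_rule R)
    (I : instance R) : R :=
  \sum_(i < njobs I |
        `[< exists k, i \in finished (gammaG_state f tie I k) >])
     value (jobs i).

(* Main.v *)
(* Upper bound.  As every job demands at most a fraction 1/h of the capacity,
   a job is rejected only while jobs of at least its density occupy a fraction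
   (h-1)/h of the capacity.  With gamma = chi^(1/kappa), the priority of a
   running job grows at least by the factor gamma per unit of time, and a job
   is interrupted only in favour of at least equal priorities.  Hence, at every
   time t at which a never completed job could be started, its density times
   (h-1)/h C is at most the sum of v chi gamma^(t-T) over the completions of
   the mechanism after t (value v, time T).  The optimum starts within each
   window of unit length jobs of total demand at most C, so each completion
   pays for v chi (1 + 1/gamma + 1/gamma^2 + ...) h/(h-1).  Jobs completed by
   both contribute the additional 1.

   Lower bound.  With C = h n, waves of carriers of total demand (h-1) n + 1
   preempt one another as their priority grows like gamma^t; only the last
   wave is completed.  At every unit of time h jobs of demand n, length 1 and
   slightly smaller density are released, of which none fits beside the
   carriers.  The optimum serves all of these and the last wave afterwards. *)
Require Import Defs.
From mathcomp Require Import all_boot all_order all_algebra.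
From mathcomp Require Import all_classical all_reals all_analysis.
From mathcomp Require Import ring lra zify.

Set Implicit Arguments.
Unset Strict Implicit.
Unset Printing Implicit Defensive.

Import Order.TTheory GRing.Theory Num.Theory.

Local Open Scope ring_scope.

(** * The greedy choice *)

(** The hypothesis excludes the branch that runs the blocked job alone, so the choice is a prefix;
    it fits because [find] returns the first overflow. *)
Lemma greedy_choice_take {R : realType} {n : nat} (C : nat) (th : 'I_n -> job R)
    (v' : 'I_n -> R) (s : seq 'I_n) :
  (forall k, (k < size s)%N ->
     (C < \sum_(i <- take k.+1 s) demand (th i))%N ->
     \sum_(i <- take 1 (drop k s)) v' i <= \sum_(i <- take k s) v' i) ->
  exists k, [/\ greedy_choice C th v' s = take k s,
    (\sum_(i <- take k s) demand (th i) <= C)%N &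
    (k < size s)%N -> (C < \sum_(i <- take k.+1 s) demand (th i))%N].
Proof.
move=> block; rewrite /greedy_choice; case: leqP => [le|gt].
  by exists (size s); rewrite take_size ltnn.
set p := (fun m => C < _)%N; set k := find p _.
have sz : (0 < size s)%N by case: s gt {block p k} => //; rewrite big_nil ltn0.
have hp : has p (iota 0 (size s)).
  apply/hasP; exists (size s).-1; first by rewrite mem_iota add0n prednK /=.
  by rewrite /p prednK // take_size.
have ks : (k < size s)%N by move: hp; rewrite has_find size_iota.
have pk : p k by have := nth_find 0%N hp; rewrite -/k nth_iota.
rewrite (block k ks pk); exists k; split => //.
case E: k => [|k']; first by rewrite take0 big_nil.
have := @before_find _ 0%N p (iota 0 (size s)) k'.
rewrite -/k E ltnSn => /(_ isT).
rewrite nth_iota ?add0n; last by apply: ltn_trans ks; rewrite E.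
by move=> /negbT; rewrite -leqNgt.
Qed.

Section Selection.
Context {R : realType} {n : nat}.
Variables (f : R -> R) (tie : tie_rule R) (th : 'I_n -> job R).
Variables (delta : 'I_n -> R).

Hypothesis tie_total : total tie.
Hypothesis tie_trans : transitive tie.

Lemma before_total : total (before f tie th delta).
Proof.
by move=> i j; rewrite /before; case: ltgtP => //= _; exact: tie_total.
Qed.

Lemma before_trans : transitive (before f tie th delta).
Proof.
move=> j i k; rewrite /before.
move=> /orP[ji|/andP[/eqP -> tij]] /orP[kj|/andP[/eqP <- tjk]].
- by rewrite (lt_trans kj ji).
- by rewrite ji.
- by rewrite kj.
- by rewrite eqxx (tie_trans tij tjk) orbT.
Qed.

Lemma before_rhoprio i j :
  before f tie th delta i j -> rhoprio f th delta j <= rhoprio f th delta i.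
Proof. by move=> /orP[/ltW//|/andP[/eqP -> _]]. Qed.

Hypothesis f_ge0 : forall i, 0 <= f (delta i).
Hypothesis value_ge0 : forall i, 0 <= value (th i).
Hypothesis demand_gt0 : forall i, (0 < demand (th i))%N.

Lemma rhoprio_ge0 i : 0 <= rhoprio f th delta i.
Proof. by rewrite /rhoprio mulr_ge0 // divr_ge0. Qed.

Lemma vprioE i : vprio f th delta i = rhoprio f th delta i * (demand (th i))%:R.
Proof.
by rewrite /vprio /rhoprio mulrAC divfK // pnatr_eq0 -lt0n.
Qed.

(* When every job demands at most half of the capacity, the jobs that fit
   before the first blocked one demand at least as much as it does, at a
   higher density; hence the mechanism never runs the blocked job alone. *)
Lemma greedy_selection (C : nat) (JF : seq 'I_n) :
  (forall i, 2 * demand (th i) <= C)%N -> uniq JF ->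
  let chosen := greedy_choice C th (vprio f th delta)
                  (sort (before f tie th delta) JF) in
  [/\ {subset chosen <= JF}, (\sum_(j in chosen) demand (th j) <= C)%N &
    forall i, i \in JF -> i \notin chosen ->
    exists k, [/\ k \in JF, k \notin chosen,
      rhoprio f th delta i <= rhoprio f th delta k,
      (C < \sum_(j in chosen) demand (th j) + demand (th k))%N &
      forall j, j \in chosen -> rhoprio f th delta k <= rhoprio f th delta j]].
Proof.
move=> half uJF; set s := sort _ JF => chosen.
have us : uniq s by rewrite sort_uniq.
have pws : pairwise (before f tie th delta) s.
  by rewrite -(sorted_pairwise before_trans) sort_sorted //; exact: before_total.
have ms : s =i JF by exact: mem_sort.
(* Position [k] of the sorted sequence holds a job [x] whose priority separates the jobs before it
   from those after it. *)
have split_at k : (k < size s)%N -> exists x, [/\ x \in s, x \notin take k s,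
    drop k s = x :: drop k.+1 s, take k.+1 s = rcons (take k s) x &
    (forall j, j \in take k s -> rhoprio f th delta x <= rhoprio f th delta j) /\
    (forall j, j \in drop k s -> rhoprio f th delta j <= rhoprio f th delta x)].
  move=> ks.
  have x0 : 'I_n by case: (s) ks => // x0.
  exists (nth x0 s k); have dk := drop_nth x0 ks.
  have := us; rewrite -{1}(cat_take_drop k s) cat_uniq dk => /and3P[_ /norP[xk _] _].
  have := pws; rewrite -{1}(cat_take_drop k s) pairwise_cat dk /= => /and4P[].
  move=> /allrelP tk _ /allP xd _; split => //; first exact: mem_nth.
    by rewrite (take_nth x0).
  split => j jk.
    by apply/before_rhoprio/tk => //; rewrite inE eqxx.
  by move: jk; rewrite inE => /orP[/eqP ->//|/xd /before_rhoprio].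
have [k [eqk lek gtk]] : exists k, [/\ chosen = take k s,
    (\sum_(i <- take k s) demand (th i) <= C)%N &
    (k < size s)%N -> (C < \sum_(i <- take k.+1 s) demand (th i))%N].
  apply: greedy_choice_take => k ks.
  have [x [_ _ -> -> [xle _]]] := split_at k ks.
  rewrite -cats1 big_cat big_seq1 => gt; rewrite /= take0 big_seq1.
  set D := (\sum_(i <- take k s) demand (th i))%N in gt *.
  (* The demands [D] and [demand (th x)] exceed [C] together, and [x] alone needs at most half of
     [C]. *)
  have xD : (demand (th x) <= D)%N by move: (half x) gt; rewrite /=; lia.
  apply: (@le_trans _ _ (rhoprio f th delta x * D%:R)).
    by rewrite vprioE ler_wpM2l ?rhoprio_ge0 // ler_nat.
  rewrite /D natr_sum mulr_sumr big_seq [leRHS]big_seq ler_sum // => j jk.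
  by rewrite vprioE ler_wpM2r // xle.
have demE : (\sum_(j in chosen) demand (th j) = \sum_(j <- take k s) demand (th j))%N.
  by rewrite eqk [RHS]big_uniq // take_uniq.
rewrite demE; split => //.
  by move=> i; rewrite eqk => /mem_take; rewrite ms.
move=> i; rewrite -ms eqk -{1}(cat_take_drop k s) mem_cat => + nit.
rewrite (negbTE nit) /= => idk.
have ks : (k < size s)%N by rewrite ltnNge; apply: contraL idk => /drop_oversize ->.
have [x [xs xk dk tk [lex gex]]] := split_at k ks.
exists x; rewrite -ms; split => //; first exact: gex.
by have := gtk ks; rewrite tk -cats1 big_cat big_seq1.
Qed.

End Selection.

(** * Critical times and the state of the mechanism *)

Lemma gt1_ltr_powR {R : realType} (a : R) : 1 < a ->
  {mono (fun x => a `^ x) : x y / x < y}.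
Proof.
move=> a1; apply: leW_mono => x y; rewrite /powR gt_eqF ?(lt_trans ltr01) //.
by rewrite ler_expR ler_pM2r // ln_gt0.
Qed.

Section Dynamics.
Context {R : realType}.
Variables (chi : R) (tie : tie_rule R) (I : instance R).
Notation n := (njobs I).
Notation th := (@jobs R I).
Notation C := (capacity I).

Definition job_density (i : 'I_n) : R := value (th i) / (demand (th i))%:R.

Notation density := job_density.

(** This is [rhoprio] for a run begun at [u], but defined at every real [t], so that priorities can
    be compared between critical times. *)
Definition run_priority (u t : R) (i : 'I_n) : R :=
  density i * chi `^ ((t - u) / len (th i)).

Notation prio := run_priority.

Definition run (s : state R n) (t : R) (i : 'I_n) : option R :=
  if start s i is Some u then
    if u + len (th i) == t then None else Some u
  else None.

(** The default [t] treats a waiting job as a run of age zero, so that running and waiting jobs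
    share one priority formula and one feasibility test. *)
Definition run_start (s : state R n) (t : R) (i : 'I_n) : R :=
  odflt t (run s t i).

Definition ended (s : state R n) (t : R) : {set 'I_n} :=
  [set i | if start s i is Some u then u + len (th i) == t else false].

Notation act := (act (fun x => chi `^ x) tie).
Notation step := (@step R (fun x => chi `^ x) tie I).

Definition candidate (s : state R n) (t : R) (i : 'I_n) : bool :=
  [&& release (th i) <= t, run_start s t i + len (th i) <= deadline (th i)
    & i \notin finished s :|: ended s t].

Hypothesis chi_gt1 : 1 < chi.
Hypothesis tie_total : total tie.
Hypothesis tie_trans : transitive tie.
Hypothesis demand_gt0 : forall i, (0 < demand (th i))%N.
Hypothesis demand_half : forall i, (2 * demand (th i) <= C)%N.
Hypothesis len_gt0 : forall i, 0 < len (th i).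
Hypothesis value_ge0 : forall i, 0 <= value (th i).

Lemma density_ge0 i : 0 <= density i.
Proof. by rewrite divr_ge0. Qed.

Lemma prio_ge0 u t i : 0 <= prio u t i.
Proof. by rewrite mulr_ge0 ?density_ge0 ?powR_ge0. Qed.

(** The interface to one round of the mechanism, with progress replaced by the start of the run. In
    the last clause [k] is the first job that did not fit. *)
Lemma act_spec (s : state R n) (t : R) : let s' := act t s in
  [/\ finished s' = finished s :|: ended s t,
    forall i, start s' i = None \/
              start s' i = Some (run_start s t i) /\ candidate s t i,
    (\sum_(j | start s' j) demand (th j) <= C)%N &
    forall i, candidate s t i -> start s' i = None ->
    exists k, [/\ candidate s t k, start s' k = None,
      prio (run_start s t i) t i <= prio (run_start s t k) t k,
      (C < \sum_(j | start s' j) demand (th j) + demand (th k))%N &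
      forall j, start s' j ->
        prio (run_start s t k) t k <= prio (run_start s t j) t j]].
Proof.
pose st i := if (if start s i is Some u then u + len (th i) == t else false)
  then None else start s i.
have stE i : st i = run s t i by rewrite /st /run; case: (start s i) => // u; case: eqP.
pose delta := progress th st t.
have rhoE i : rhoprio (fun x => chi `^ x) th delta i = prio (run_start s t i) t i.
  rewrite /rhoprio /run_priority /delta /progress stE /run_start; case: (run s t i) => //=.
  by rewrite subrr mul0r.
have feasE i : feasible_job th delta (finished s :|: ended s t) t i = candidate s t i.
  rewrite /feasible_job /candidate; congr [&& _, _ & _].
  rewrite /delta /progress stE /run_start; case: (run s t i) => [u|] /=.
    have l0 := lt0r_neq0 (len_gt0 i).
    by rewrite mulrBl mul1r divfK //; lra.
  by rewrite subr0 mul1r; lra.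
pose JF := [seq i <- enum 'I_n | feasible_job th delta (finished s :|: ended s t) t i].
pose ch := greedy_choice C th (vprio (fun x => chi `^ x) th delta)
             (sort (before (fun x => chi `^ x) tie th delta) JF).
have memJF i : (i \in JF) = candidate s t i.
  by rewrite mem_filter mem_enum andbT feasE.
have [|chJF chC chrej] := @greedy_selection R n (fun x => chi `^ x) tie th delta
  tie_total tie_trans (fun i => powR_ge0 _ _) value_ge0 demand_gt0 C JF demand_half.
  by rewrite filter_uniq // enum_uniq.
rewrite -/ch in chJF chC chrej.
move=> s'.
have startE i : start s' i = if i \in ch then Some (run_start s t i) else None.
  by rewrite /run_start -stE.
have sE i : (start s' i : bool) = (i \in ch) by rewrite startE; case: ifP.
have sumE : (\sum_(j | start s' j) demand (th j) = \sum_(j in ch) demand (th j))%N.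
  by apply: eq_bigl => i; rewrite sE.
split => //.
- move=> i; rewrite startE; case: ifP => [ich|_]; last by left.
  by right; split => //; rewrite -memJF chJF.
- by rewrite sumE.
move=> i ci; rewrite startE; case: ifP => // /negbT ich _.
have [|k [kJ kch ik gt lek]] := chrej i _ ich; first by rewrite memJF.
exists k; rewrite -memJF startE (negbTE kch) sumE -!rhoE; split => // j.
by rewrite sE -rhoE => /lek.
Qed.


(** * Invariants along the critical times *)

Definition next_critical (s : state R n) (t : R) : Prop :=
  t \in critical_times s /\ forall c, c \in critical_times s -> t <= c.

Lemma critical_timesP (s : state R n) (t : R) :
  reflect ((exists2 i, now s < release (th i) & t = release (th i)) \/
           (exists i u, start s i = Some u /\ t = u + len (th i)))
          (t \in critical_times s).
Proof.
rewrite /critical_times mem_cat; apply: (iffP orP) => -[].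
- by move=> /mapP[i]; rewrite mem_filter => /andP[ri _] ->; left; exists i.
- rewrite mem_pmap => /mapP[i _]; case E: (start s i) => [u|] //= [->].
  by right; exists i, u.
- move=> [i ri ->]; left; apply/mapP; exists i => //.
  by rewrite mem_filter ri mem_enum.
- move=> [i [u [su ->]]]; right; rewrite mem_pmap; apply/mapP; exists i.
    exact: mem_enum.
  by rewrite su.
Qed.

Lemma step_cases (s : state R n) :
  (critical_times s = [::] /\ step s = s) \/
  exists2 t, next_critical s t & step s = act t s.
Proof.
rewrite /Defs.step; case E: (critical_times s) => [|t ts]; first by left.
right; exists (foldr Order.min t ts) => //; rewrite /next_critical E {E}.
elim: ts => [|a ts [IH1 IH2]] /=.
  by rewrite inE eqxx; split => // c; rewrite inE => /eqP ->.
split; last first.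
  move=> c; rewrite !inE ge_min => /or3P[/eqP ->|/eqP ->|cts].
  - by rewrite IH2 ?orbT // mem_head.
  - by rewrite lexx.
  - by rewrite IH2 ?orbT // inE cts orbT.
rewrite minEle; case: ifP => _; first by rewrite !inE eqxx orbT.
by move: IH1; rewrite !inE => /orP[->//|->]; rewrite !orbT.
Qed.

(** The bound [now s < u + len (th i)] is strict because a run ending at [now s] has already been
    moved to [finished]. It makes critical times strictly increasing. *)
Definition running_ok (s : state R n) : Prop :=
  forall i u, start s i = Some u ->
    [/\ release (th i) <= u, u <= now s, now s < u + len (th i),
        u + len (th i) <= deadline (th i) & i \notin finished s].

Lemma critical_gt (s : state R n) (t : R) :
  running_ok s -> t \in critical_times s -> now s < t.
Proof.
by move=> ok /critical_timesP[[i ri ->]//|[i [u [/ok[_ _ + _ _] ->]]]].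
Qed.

Lemma running_ok_act (s : state R n) (t : R) :
  running_ok s -> next_critical s t -> running_ok (act t s).
Proof.
move=> ok [tc tmin] i u su'.
have nt := critical_gt ok tc.
have [finE startE _ _] := act_spec s t.
have [|[]] := startE i; rewrite su' // => -[->] /and3P[ri di fi].
rewrite finE fi; split => //=; rewrite /run_start /run.
- by case E: (start s i) => [v|] //=; case: eqP => //= _; have [] := ok _ _ E.
- case E: (start s i) => [v|] //=; case: eqP => //= _.
  by have [_ + _ _ _] := ok _ _ E; move: nt; lra.
- case E: (start s i) => [v|] //=; last by rewrite ltrDl.
  case: eqP => /= [_|/eqP ne]; first by rewrite ltrDl.
  rewrite lt_neqAle eq_sym ne /= tmin //; apply/critical_timesP; right.
  by exists i, v.
Qed.

(** A termination measure: each critical time uses up a future release or finishes a job. *)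
Definition remaining (s : state R n) : nat :=
  (#|[set i | (now s < release (th i))%R]| + #|~: finished s|)%N.

Lemma remaining_act (s : state R n) (t : R) :
  running_ok s -> next_critical s t -> (remaining (act t s) < remaining s)%N.
Proof.
move=> ok [tc tmin]; have nt := critical_gt ok tc.
have [finE _ _ _] := act_spec s t.
rewrite /remaining finE /=.
have sub1 : [set i | t < release (th i)] \subset [set i | now s < release (th i)].
  by apply/fintype.subsetP => i; rewrite !inE; apply: lt_trans.
have sub2 : ~: (finished s :|: ended s t) \subset ~: finished s.
  by rewrite finset.setCS finset.subsetUl.
case/critical_timesP: (tc) => [[i ri ti]|[i [u [su ti]]]].
  rewrite -addSn leq_add ?subset_leq_card // proper_card // finset.properEneq sub1 andbT.
  by apply/eqP => /setP/(_ i); rewrite !inE ri ti ltxx.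
rewrite -addnS leq_add ?subset_leq_card // proper_card // finset.properEneq sub2 andbT.
apply/eqP => /setP/(_ i); rewrite !inE su -ti eqxx orbT /=.
by have [_ _ _ _ ->] := ok _ _ su.
Qed.

Lemma finished_step (s : state R n) : finished s \subset finished (step s).
Proof.
have [[_ ->]//|[t _ ->]] := step_cases s.
by have [-> _ _ _] := act_spec s t; rewrite finset.subsetUl.
Qed.

Lemma finished_iter m (s : state R n) : finished s \subset finished (iter m step s).
Proof.
by elim: m => //= m IH; apply: fintype.subset_trans IH (finished_step _).
Qed.

End Dynamics.

(** * Credit of future completions *)

Lemma ler_sum_sub {R : numDomainType} (J : finType) (P Q : pred J) (F : J -> R) :
  (forall j, P j -> Q j) -> (forall j, Q j -> 0 <= F j) ->
  \sum_(j | P j) F j <= \sum_(j | Q j) F j.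
Proof.
move=> PQ F0; rewrite [leRHS](bigID P) /=.
rewrite (eq_bigl P) => [|j]; last by rewrite andb_idl //; exact: PQ.
by rewrite lerDl sumr_ge0 // => j /andP[/F0].
Qed.

Lemma leq_sum_sub (J : finType) (P Q : pred J) (F : J -> nat) :
  (forall j, P j -> Q j) -> (\sum_(j | P j) F j <= \sum_(j | Q j) F j)%N.
Proof.
move=> PQ; rewrite [leqRHS](bigID P) /=.
rewrite (eq_bigl P) => [|j]; last by rewrite andb_idl //; exact: PQ.
exact: leq_addr.
Qed.

Section Credit.
Context {R : realType}.
Variables (chi : R) (tie : tie_rule R) (I : instance R) (h : nat) (kappa : R).
Notation n := (njobs I).
Notation th := (@jobs R I).
Notation C := (capacity I).
Notation act := (act (fun x => chi `^ x) tie).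
Notation step := (@step R (fun x => chi `^ x) tie I).
Notation prio := (@run_priority R chi I).
Notation density := (@job_density R I).

Hypothesis chi_gt1 : 1 < chi.
Hypothesis tie_total : total tie.
Hypothesis tie_trans : transitive tie.
Hypothesis h_ge2 : (2 <= h)%N.
Hypothesis demand_gt0 : forall i, (0 < demand (th i))%N.
Hypothesis demand_le : forall i, (h * demand (th i) <= C)%N.
Hypothesis len_gt0 : forall i, 0 < len (th i).
Hypothesis len_le : forall i, len (th i) <= kappa.
Hypothesis value_ge0 : forall i, 0 <= value (th i).
Hypothesis kappa_gt0 : 0 < kappa.

Let chi_gt0 : 0 < chi. Proof. exact: lt_trans chi_gt1. Qed.

Let demand_half i : (2 * demand (th i) <= C)%N.
Proof. by apply: leq_trans (demand_le i); rewrite leq_mul2r h_ge2 orbT. Qed.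

(* Whenever a job is rejected, jobs of at least its density occupy at least
   this much capacity. *)
Definition floor_load : R := (h%:R - 1) / h%:R * C%:R.

(** With gamma the [kappa]-th root of [chi], this is gamma to the power [x]: the growth of the
    priority of a job of length [kappa], the slowest possible, over a duration [x]. *)
Definition disc (x : R) : R := chi `^ (x / kappa).

Lemma discD x y : disc (x + y) = disc x * disc y.
Proof. by rewrite /disc mulrDl powRD // (gt_eqF chi_gt0) implybT. Qed.

Lemma disc_gt0 x : 0 < disc x. Proof. exact: powR_gt0. Qed.

Lemma disc_ge1 x : 0 <= x -> 1 <= disc x.
Proof.
by move=> x0; rewrite -(powRr0 chi) ler_powR ?(ltW chi_gt1) // divr_ge0 // ltW.
Qed.

Lemma discNK x : disc (- x) * disc x = 1.
Proof. by rewrite -discD addNr /disc mul0r powRr0. Qed.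

Lemma prio_grow u r t j : r <= t -> prio u r j * disc (t - r) <= prio u t j.
Proof.
move=> rt; rewrite /run_priority -mulrA ler_wpM2l ?density_ge0 //.
rewrite /disc -powRD ?(gt_eqF chi_gt0) ?implybT // ler_powR ?(ltW chi_gt1) //.
have -> : (t - u) / len (th j) = (r - u) / len (th j) + (t - r) / len (th j).
  by rewrite -mulrDl; congr (_ / _); lra.
by rewrite lerD2l ler_wpM2l ?subr_ge0 // lef_pV2 ?posrE.
Qed.

Lemma prio_start u j : prio u u j = density j.
Proof. by rewrite /run_priority subrr mul0r powRr0 mulr1. Qed.

Lemma density_grow u t j : u <= t -> density j * disc (t - u) <= prio u t j.
Proof. by move=> ut; rewrite -(prio_start u j) prio_grow. Qed.

Definition dense (s : state R n) (r x : R) (j : 'I_n) : bool :=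
  if start s j is Some u then x <= prio u r j else false.

Definition load (s : state R n) (r x : R) : nat :=
  (\sum_(j | dense s r x j) demand (th j))%N.

Lemma load_mono (s : state R n) r r' x y :
  (forall j u, start s j = Some u -> x <= prio u r j -> y <= prio u r' j) ->
  (load s r x <= load s r' y)%N.
Proof.
move=> H; apply: leq_sum_sub => j.
by rewrite /dense; case E: (start s j) => [u|] // /(H _ _ E).
Qed.

(** The started jobs and the first blocked job exceed [C] together, the latter needs at most
    [C / h], and every started job has at least its priority, hence at least that of [i]. *)
Lemma rejected_load (s : state R n) t i :
  candidate s t i -> start (act t s) i = None ->
  floor_load <= (load (act t s) t (prio (run_start s t i) t i))%:R.
Proof.
move=> ci si.
have [_ startE _ rej] := act_spec chi tie_total tie_trans demand_gt0 demand_half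
  len_gt0 value_ge0 s t.
have [k [ck sk ik gt le]] := rej i ci si.
set L := load _ _ _.
have : (C < L + demand (th k))%N.
  apply: leq_trans gt _; rewrite leq_add2r; apply: leq_sum_sub => // j sj.
  rewrite /dense; have := le j sj; have [E|[-> _]] := startE j; first by rewrite E in sj.
  exact: le_trans.
rewrite /floor_load => {}gt.
have h0 : 0 < h%:R :> R by rewrite ltr0n; lia.
rewrite mulrAC ler_pdivrMr //.
have : ((h - 1) * C <= L * h)%N by move: (demand_le k) gt; nia.
by rewrite -(ler_nat R) !natrM natrB //; lia.
Qed.

(** When no critical time is left, [step] changes nothing, so surplus entries carry the value 0. *)
Fixpoint completions (m : nat) (s : state R n) : seq (R * R) :=
  if m is m'.+1 then
    (now (step s), \sum_(j in finished (step s) :\: finished s) value (th j))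
      :: completions m' (step s)
  else [::].

(* The completed value, each completion at time T being discounted at time
   t <= T as if the job had been growing at the slowest possible rate. *)
Definition credit (ps : seq (R * R)) (t : R) : R :=
  \sum_(p <- ps | t <= p.1) p.2 * (chi * disc (t - p.1)).

Lemma completion_ge0 m s p : p \in completions m s -> 0 <= p.2.
Proof.
elim: m s => //= m IH s; rewrite inE => /orP[/eqP ->|/IH//] /=.
exact: sumr_ge0.
Qed.

Lemma credit_ge0 m s t : 0 <= credit (completions m s) t.
Proof.
rewrite /credit big_seq_cond sumr_ge0 // => p /andP[/completion_ge0 p0 _].
by rewrite mulr_ge0 // mulr_ge0 ?(ltW chi_gt0) ?(ltW (disc_gt0 _)).
Qed.

Lemma credit_step m s t :
  credit (completions m (step s)) t <= credit (completions m.+1 s) t.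
Proof.
rewrite /credit /= big_cons; case: ifP => // _; rewrite lerDr mulr_ge0 ?sumr_ge0 //.
by rewrite mulr_ge0 ?(ltW chi_gt0) ?(ltW (disc_gt0 _)).
Qed.

(** The threshold rises with [disc], no faster than any running priority, so a job above it stays
    above it until it completes or is interrupted. A completion pays its share into the credit; an
    interruption leaves a load of at least [floor_load] above the threshold. As only that much
    survives an interruption, the load is capped by [Num.min]. *)
Lemma load_le_credit m (s : state R n) (t r x : R) :
  running_ok s -> (remaining s <= m)%N -> 0 <= x -> t <= r -> now s <= r ->
  (forall c, c \in critical_times s -> r <= c) ->
  x * Num.min floor_load (load s r (x * disc (r - t)))%:R
    <= credit (completions m s) t.
Proof.
have floor_ge0 : 0 <= floor_load.
  by rewrite !mulr_ge0 ?invr_ge0 // subr_ge0 ler1n; lia.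
have load0 s' r' y : (forall i, start s' i = None) -> load s' r' y = 0%N.
  by move=> s0; rewrite /load big_pred0 // => j; rewrite /dense s0.
(* With measure 0 every job is finished, so nothing runs and the load is 0. *)
elim: m s r => [|m IH] s r ok.
  rewrite leqn0 addn_eq0 => /andP[_ /eqP/cards0_eq fin] x0 _ _ _.
  rewrite load0 ?min_r // ?mulr0 ?credit_ge0 // => i.
  case E: (start s i) => [u|] //; have [_ _ _ _] := ok _ _ E.
  by move/setP: fin => /(_ i); rewrite !inE => ->.
move=> rem x0 tr nr rc.
have [[c0 _]|[t' nxt stepE]] := step_cases chi tie s.
  rewrite load0 ?min_r // ?mulr0 ?credit_ge0 // => i.
  case E: (start s i) => [u|] //.
  have : u + len (th i) \in critical_times s by apply/critical_timesP; right; exists i, u.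
  by rewrite c0.
have [tc tmin] := nxt; have rt := rc _ tc; have tt := le_trans tr rt.
have ok' : running_ok (act t' s) by apply: running_ok_act.
have rem' : (remaining (act t' s) <= m)%N.
  by rewrite -ltnS; apply: leq_trans rem; apply: remaining_act.
have nxt' c : c \in critical_times (act t' s) -> t' <= c.
  by move=> /(critical_gt ok')/ltW.
have IH' := IH (act t' s) t' ok' rem' x0 tt (lexx _) nxt'.
have [finE startE _ _] := act_spec chi tie_total tie_trans demand_gt0 demand_half
  len_gt0 value_ge0 s t'.
have rejl := @rejected_load s t'.
have now_s' : now (act t' s) = t' by [].
move: (act t' s) stepE ok' rem' nxt' IH' finE startE rejl now_s' => s' stepE ok' _ nxt' IH'
  finE startE rejl now_s'.
set y := x * disc (t' - t) in IH'.
have grow : (load s r (x * disc (r - t)) <= load s t' y)%N.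
  apply: load_mono => j u sj xj; apply: le_trans (prio_grow _ _ rt).
  have -> : y = x * disc (r - t) * disc (t' - r).
    by rewrite /y -mulrA -discD; congr (_ * disc _); lra.
  by rewrite ler_wpM2r // ltW ?disc_gt0.
apply: (@le_trans _ _ (x * Num.min floor_load (load s t' y)%:R)).
  by rewrite ler_wpM2l // le_min2 // ler_nat.
(* First case: a job above the threshold is interrupted at [t']. Its rejection alone guarantees the
   load [floor_load] in the new state. *)
case: (boolP [exists j, [&& dense s t' y j, j \notin ended s t' & start s' j == None]]).
  move=> /existsP[j /and3P[dj ej /eqP sj]].
  move: dj ej; rewrite /dense inE; case E: (start s j) => [u|] // yj uj.
  have [ru un nu ud fj] := ok _ _ E.
  have rsE : run_start s t' j = u by rewrite /run_start /run E (negbTE uj).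
  have cj : candidate s t' j.
    rewrite /candidate rsE ud !inE E (negbTE uj) (negbTE fj) /= !andbT.
    have := critical_gt ok tc; lra.
  have := rejl _ cj sj; rewrite rsE => fl.
  have fl' : floor_load <= (load s' t' y)%:R.
    apply: le_trans fl _; rewrite ler_nat; apply: load_mono => i v _.
    exact: le_trans.
  apply: le_trans (credit_step _ _ _); rewrite stepE; apply: le_trans IH'.
  by rewrite (min_l fl') ler_wpM2l // ge_min lexx.
rewrite negb_exists => /forallP stay.
(* Second case: each job above the threshold either ends at [t'], and is counted in [E], or keeps
   running. *)
set E := \sum_(j | dense s t' y j && (j \in ended s t')) x * (demand (th j))%:R.
have split_load : (load s t' y)%:R * x <= x * (load s' t' y)%:R + E.
  rewrite mulrC /load !natr_sum !mulr_sumr (bigID (mem (ended s t'))) /= addrC.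
  apply: lerD => //; apply: ler_sum_sub => [j|j _]; last by rewrite mulr_ge0.
  move=> /andP[dj ej]; have := stay j; rewrite dj ej andTb andTb; move: dj ej.
  rewrite /dense inE; case sj: (start s j) => [u|] // yj uj.
  have [-> //|[-> _] _] := startE j.
  by rewrite /run_start /run sj (negbTE uj).
rewrite /credit /= big_cons stepE now_s' /= tt -/(credit _ _).
have E_le : E <= (\sum_(j in finished s' :\: finished s) value (th j))
              * (chi * disc (t - t')).
  rewrite mulr_suml; apply: (@le_trans _ _ (\sum_(j | dense s t' y j && (j \in ended s t'))
     value (th j) * (chi * disc (t - t')))).
    apply: ler_sum => j /andP[]; rewrite /dense inE.
    case sj: (start s j) => [u|] // yj /eqP uj.
    (* At its end the progress of the job is 1, so its priority is its density times [chi]. *)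
    move: yj; rewrite /run_priority -uj addrAC subrr add0r divff ?lt0r_neq0 //.
    rewrite powRr1 ?(ltW chi_gt0) //.
    rewrite /y uj => yj.
    have dpos : 0 < (demand (th j))%:R :> R by rewrite ltr0n.
    have vE : value (th j) = density j * (demand (th j))%:R.
      by rewrite /job_density divfK // gt_eqF.
    have inv : disc (t - t') * disc (t' - t) = 1 by rewrite -(opprB t' t) discNK.
    have : x * disc (t' - t) * disc (t - t') <= density j * chi * disc (t - t').
      by rewrite ler_wpM2r // ltW ?disc_gt0.
    rewrite -mulrA (mulrC (disc (t' - t))) inv mulr1 => xj.
    rewrite vE.
    have -> : density j * (demand (th j))%:R * (chi * disc (t - t')) =
      density j * chi * disc (t - t') * (demand (th j))%:R by ring.
    by rewrite ler_wpM2r // ltW.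
  apply: ler_sum_sub => [j /andP[_]|j _]; last first.
    by rewrite !mulr_ge0 ?(ltW chi_gt0) ?(ltW (disc_gt0 _)).
  rewrite finE !inE; case sj: (start s j) => [u|] // ->; rewrite orbT andbT.
  by have [_ _ _ _ ->] := ok _ _ sj.
apply: (@le_trans _ _ (E + x * Num.min floor_load (load s' t' y)%:R)); last first.
  by apply: lerD => //; apply: IH'.
have E0 : 0 <= E by rewrite sumr_ge0 // => j _; rewrite mulr_ge0.
case: (leP floor_load (load s' t' y)%:R) => _.
  by apply: (@le_trans _ _ (x * floor_load)); [rewrite ler_wpM2l // ge_min lexx | lra].
apply: (@le_trans _ _ (x * (load s t' y)%:R)); first by rewrite ler_wpM2l // ge_min lexx orbT.
lra.
Qed.


(** * Credit available to a job that is never completed *)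

Lemma density_le_prio u t j : u <= t -> density j <= prio u t j.
Proof.
move=> ut; apply: le_trans (density_grow j ut).
by rewrite ler_peMr ?density_ge0 // disc_ge1 // subr_ge0.
Qed.

(** Holds after every critical time because an idle job that could still start has just been
    rejected, at a priority no lower than its density. *)
Definition decided (s : state R n) : Prop :=
  forall i, release (th i) <= now s -> start s i = None -> i \notin finished s ->
    now s + len (th i) <= deadline (th i) ->
    floor_load <= (load s (now s) (density i))%:R.

Lemma decided_act (s : state R n) t :
  running_ok s -> next_critical s t -> decided (act t s).
Proof.
move=> ok [tc tmin] i ri si fi di.
have [finE _ _ _] := act_spec chi tie_total tie_trans demand_gt0 demand_half
  len_gt0 value_ge0 s t.
have nt := critical_gt ok tc.
have [rs ds] : run_start s t i <= t /\ run_start s t i + len (th i) <= deadline (th i).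
  rewrite /run_start /run; case E: (start s i) => [u|] //=; case: eqP => //= _.
  by have [_ un _ ud _] := ok _ _ E; split => //; lra.
have ci : candidate s t i by rewrite /candidate ri ds -finE.
apply: le_trans (rejected_load ci si) _; rewrite ler_nat; apply: load_mono => j u _.
by apply: le_trans; apply: density_le_prio.
Qed.

Lemma unfinished_run (s : state R n) m i u t :
  start s i = Some u -> i \notin finished (iter m.+1 step s) ->
  step s = act t s -> running_ok s -> next_critical s t ->
  run_start s t i = u /\ (start (act t s) i = Some u \/
    candidate s t i /\ start (act t s) i = None).
Proof.
move=> si fi stepE ok [tc _].
have [finE startE _ _] := act_spec chi tie_total tie_trans demand_gt0 demand_half
  len_gt0 value_ge0 s t.
have fi' : i \notin finished s :|: ended s t.
  rewrite -finE -stepE; apply: contra fi; rewrite iterSr.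
  exact/fintype.subsetP/finished_iter.
have rsE : run_start s t i = u.
  by move: fi'; rewrite !inE /run_start /run si; case: eqP; rewrite ?orbT.
split => //; have [sN|[-> _]] := startE i; last by left; rewrite rsE.
right; split => //; have [ru un _ ud _] := ok _ _ si; have nt := critical_gt ok tc.
by rewrite /candidate fi' rsE ud !andbT; lra.
Qed.

(** A run that never finishes must be interrupted at some later [t']. As it began by time [t], its
    priority has then grown by at least [disc (t' - t)], which is the threshold required by
    [load_le_credit]. *)
Lemma running_credit m (s : state R n) (i : 'I_n) (u t : R) :
  running_ok s -> (remaining s <= m)%N -> i \notin finished (iter m step s) ->
  start s i = Some u -> u <= t -> (forall c, c \in critical_times s -> t <= c) ->
  density i * floor_load <= credit (completions m s) t.
Proof.
elim: m s => [|m IH] s ok rem fi si ut tle.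
  move: rem; rewrite leqn0 addn_eq0 => /andP[_ /eqP/cards0_eq fin].
  by move/setP: fin => /(_ i); rewrite !inE fi.
have [[c0 _]|[t' nxt stepE]] := step_cases chi tie s.
  have : u + len (th i) \in critical_times s by apply/critical_timesP; right; exists i, u.
  by rewrite c0.
have tt := tle _ nxt.1.
have ok' : running_ok (act t' s) by apply: running_ok_act.
have rem' : (remaining (act t' s) <= m)%N.
  by rewrite -ltnS; apply: leq_trans rem; apply: remaining_act.
have nxt' c : c \in critical_times (act t' s) -> t' <= c.
  by move=> /(critical_gt ok')/ltW.
apply: le_trans (credit_step _ _ _); rewrite stepE.
have [rsE [si'|[ci si']]] := unfinished_run si fi stepE ok nxt.
  apply: IH si' ut _ => //; first by move: fi; rewrite iterSr stepE.
  by move=> c /nxt'; apply: le_trans.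
have fl := rejected_load ci si'; rewrite rsE in fl.
have fl' : floor_load <=
    (load (act t' s) t' (density i * disc (t' - t)))%:R.
  apply: le_trans fl _; rewrite ler_nat; apply: load_mono => j v _.
  apply: le_trans; apply: le_trans (density_grow _ (le_trans ut tt)).
  by rewrite ler_wpM2l ?density_ge0 // ler_powR ?(ltW chi_gt1) // ler_pM2r ?invr_gt0 //; lra.
by have := load_le_credit ok' rem' (density_ge0 value_ge0 i) tt (lexx _) nxt'; rewrite min_l.
Qed.

(** The induction moves to the last critical time not after [t]. There the job is either running,
    which is the case of [running_credit], or idle, and then [decided] supplies the load. *)
Lemma unfinished_credit m (s : state R n) (i : 'I_n) (t : R) :
  running_ok s -> decided s -> (remaining s <= m)%N ->
  i \notin finished (iter m step s) ->
  release (th i) <= t -> t + len (th i) <= deadline (th i) -> now s <= t ->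
  density i * floor_load <= credit (completions m s) t.
Proof.
elim: m s => [|m IH] s ok dec rem fi rt td nt.
  move: rem; rewrite leqn0 addn_eq0 => /andP[_ /eqP/cards0_eq fin].
  by move/setP: fin => /(_ i); rewrite !inE fi.
have fis : i \notin finished s by apply: contra fi; exact/fintype.subsetP/finished_iter.
(* The load known at [now s] persists up to [t], since priorities of running jobs only grow and no
   critical time lies strictly between. *)
have idle_credit : start s i = None -> release (th i) <= now s ->
    (forall c, c \in critical_times s -> t <= c) ->
    density i * floor_load <= credit (completions m.+1 s) t.
  move=> si ri tle.
  have di : now s + len (th i) <= deadline (th i) by lra.
  have fl := dec i ri si fis di.
  have fl' : floor_load <= (load s t (density i * disc (t - t)))%:R.
    apply: le_trans fl _; rewrite ler_nat; apply: load_mono => j v _.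
    rewrite subrr /disc mul0r powRr0 mulr1 => /le_trans; apply.
    apply: le_trans (prio_grow _ _ nt).
    by rewrite ler_peMr ?prio_ge0 // disc_ge1 // subr_ge0.
  by have := load_le_credit ok rem (density_ge0 value_ge0 i) (lexx t) nt tle; rewrite min_l.
have [[c0 _]|[t' nxt stepE]] := step_cases chi tie s.
  apply: idle_credit; rewrite ?c0 //.
    case si: (start s i) => [u|] //.
    have : u + len (th i) \in critical_times s by apply/critical_timesP; right; exists i, u.
    by rewrite c0.
  rewrite leNgt; apply/negP => lt.
  have : release (th i) \in critical_times s by apply/critical_timesP; left; exists i.
  by rewrite c0.
case: (leP t' t) => [t't|tt'].
  apply: le_trans (credit_step _ _ _); rewrite stepE; apply: IH => //.
  - exact: running_ok_act.
  - exact: decided_act.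
  - by rewrite -ltnS; apply: leq_trans rem; apply: remaining_act.
  - by move: fi; rewrite iterSr stepE.
have tle c : c \in critical_times s -> t <= c.
  by move=> /nxt.2; apply: le_trans; exact: ltW.
case si: (start s i) => [u|].
  have [_ un _ _ _] := ok _ _ si.
  exact: (running_credit ok rem fi si (le_trans un nt) tle).
apply: idle_credit => //; rewrite leNgt; apply/negP => lt.
have : release (th i) \in critical_times s by apply/critical_timesP; left; exists i.
by move=> /nxt.2; rewrite leNgt (le_lt_trans rt tt').
Qed.

End Credit.

(** * Upper bound *)

(* The unit windows ]T - 1, T], ]T - 2, T - 1], ... contain total weight at
   most [c] each, whence a geometric series. *)
Lemma discounted_packing {R : realType} (chi kappa c : R) (J : finType)
    (P : pred J) (s w : J -> R) (T : R) :
  1 < chi -> 0 < kappa -> 0 <= c ->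
  (forall j, 0 <= w j) -> (forall j, P j -> 0 <= s j) ->
  (forall t, \sum_(j | P j && (s j <= t < s j + 1)) w j <= c) ->
  (\sum_(j | P j && (s j <= T)) w j * disc chi kappa (s j - T))
    * (1 - disc chi kappa (- 1)) <= c.
Proof.
move=> chi1 k0 c0 w0 s0 pack.
have d0 x : 0 < disc chi kappa x by exact: disc_gt0.
have d1 : disc chi kappa (-1) <= 1.
  rewrite -(ler_pM2r (d0 1)) discNK // mul1r; apply: disc_ge1 => //.
have [N TN] : exists N : nat, T < N%:R.
  by exists (Num.truncn T).+1; exact: truncnS_gt.
elim: N T TN => [|N IH] T TN.
  (* Here [T] is negative, while all [s j] are nonnegative. *)
  rewrite big_pred0 ?mul0r // => j; apply/negP => /andP[/s0]; move: TN; lra.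
rewrite (bigID (fun j => s j <= T - 1)) /=.
have -> : \sum_(j | (P j && (s j <= T)) && (s j <= T - 1)) w j * disc chi kappa (s j - T)
   = (\sum_(j | P j && (s j <= T - 1)) w j * disc chi kappa (s j - (T - 1)))
     * disc chi kappa (-1).
  rewrite mulr_suml; apply: eq_big => [j|j _].
    rewrite -andbA; congr (_ && _); apply/andP/idP => [[]//|sT]; split => //.
    by move: sT; lra.
  by rewrite -mulrA -discD //; congr (_ * disc _ _ _); lra.
have IHT : T - 1 < N%:R by move: TN; rewrite -natr1; lra.
have {IHT}IHT := IH _ IHT.
set A := \sum_(j | _) _ in IHT *; set B := \sum_(j | _) _.
have Bc : B <= c.
  apply: le_trans (pack T); rewrite /B.
  rewrite (eq_bigl (fun j => P j && (s j <= T < s j + 1))); last first.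
    by move=> j; rewrite -andbA; congr [&& _, _ & _]; rewrite -ltNge; lra.
  apply: ler_sum => j /and3P[_ sT _]; rewrite ler_piMr //.
  rewrite -(ler_pM2r (d0 (T - s j))) -(opprB T) discNK // mul1r disc_ge1 //; lra.
(* With [d = disc chi kappa (-1)], the bounds on [A] and [B] give [(A * d + B) * (1 - d) <= d * c +
   (1 - d) * c = c]. *)
have := d0 (-1).
have : 0 <= (c - B) * (1 - disc chi kappa (-1)) by rewrite mulr_ge0 // subr_ge0.
have : 0 <= disc chi kappa (-1) * (c - A * (1 - disc chi kappa (-1))).
  by rewrite mulr_ge0 ?(ltW (d0 _)) // subr_ge0.
lra.
Qed.

Section UpperBound.
Context {R : realType}.
Variables (h kappa : nat) (chi : R) (tie : tie_rule R).
Hypothesis h_ge2 : (2 <= h)%N.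
Hypothesis kappa_ge1 : (1 <= kappa)%N.
Hypothesis chi_gt1 : 1 < chi.
Hypothesis tie_total : total tie.
Hypothesis tie_trans : transitive tie.

Notation f := (fun delta => chi `^ delta).

Lemma sum_completions (I : instance R) m s :
  (forall s, finished s \subset finished (@step R f tie I s)) ->
  \sum_(p <- completions chi tie m s) p.2 + \sum_(i in finished s) value (@jobs R I i)
    = \sum_(i in finished (iter m (@step R f tie I) s)) value (jobs i).
Proof.
move=> mono; elim: m s => [|m IH] s; first by rewrite big_nil add0r.
rewrite iterSr -IH /= big_cons /= addrAC addrC; congr (_ + _).
by rewrite addrC [RHS](big_setID (finished s)) /= (finset.setIidPr (mono s)).
Qed.

Lemma mechanism_upper_bound (I : instance R) :
  instance_class h kappa I ->
  OPT I <= (h%:R / (h%:R - 1) * (chi / (1 - chi `^ (- (kappa%:R)^-1))) + 1)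
           * gammaG_welfare f tie I.
Proof.
move=> [valid cap].
pose th := @jobs R I.
have k0 : 0 < kappa%:R :> R by rewrite ltr0n.
have dem0 i : (0 < demand (th i))%N by have [] := valid i.
have demC i : (h * demand (th i) <= capacity I)%N.
  apply: leq_trans cap; rewrite leq_mul2l; apply/orP; right.
  exact: (leq_bigmax i).
have dem2 i : (2 * demand (th i) <= capacity I)%N.
  by apply: leq_trans (demC i); rewrite leq_mul2r h_ge2 orbT.
have len1 i : 1 <= len (th i) by have [_ _ /andP[]] := valid i.
have lenk i : len (th i) <= kappa%:R by have [_ _ /andP[]] := valid i.
have len0 i : 0 < len (th i) by apply: lt_le_trans (len1 i).
have v0 i : 0 <= value (th i) by have [_ _ _ /ltW] := valid i.
have rel0 i : 0 <= release (th i) by have [] := valid i.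
have [[a fa ->] _] := OPT_attained I; rewrite /social_welfare.
pose done i := `[< exists k, i \in finished (gammaG_state f tie I k) >].
set W := gammaG_welfare f tie I.
have W0 : 0 <= W by exact: sumr_ge0.
(* Starting times of the jobs completed by the optimal allocation [a]; the value 0 for the other
   jobs is a dummy. *)
have [s sP] : exists s : 'I_(njobs I) -> R, forall i, completes a i ->
    [/\ release (th i) <= s i, s i + len (th i) <= deadline (th i)
      & forall t, s i <= t < s i + len (th i) -> (demand (th i) <= a i t)%N].
  suff /choice[s sP] : forall i, exists x, completes a i ->
      [/\ release (th i) <= x, x + len (th i) <= deadline (th i)
        & forall t, x <= t < x + len (th i) -> (demand (th i) <= a i t)%N] by exists s.
  by move=> i; have [[x xP]|nc] := pselect (completes a i); [exists x | exists 0].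
(* Jobs completed by both schedules are worth at most [W], which gives the summand 1. *)
rewrite (bigID done) /= mulrDl mul1r addrC; apply: lerD; last first.
  by apply: ler_sum_sub => // j /andP[].
set P := fun i => `[< completes a i >] && ~~ done i; set X := \sum_(i | P i) _.
have -> : chi `^ (- kappa%:R^-1) = disc chi kappa%:R (-1) by rewrite /disc mulN1r.
set d := disc _ _ _.
have d1 : d < 1.
  rewrite /d /disc mulN1r -[ltRHS](powRr0 chi) (gt1_ltr_powR chi_gt1) oppr_lt0.
  by rewrite invr_gt0.
have [C0|C0] := posnP (capacity I).
  rewrite /X big_pred0 => [|i]; last by move: (demC i) (dem0 i); rewrite C0; nia.
  rewrite !mulr_ge0 ?invr_ge0 ?subr_ge0 ?ler1n ?(ltW d1) ?(ltW (lt_trans ltr01 chi_gt1)) //; lia.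
set s0 : state R (njobs I) := init R (njobs I).
set ps := completions chi tie (remaining s0) s0.
have unfin i : P i -> job_density i * floor_load I h <= credit chi kappa%:R ps (s i).
  move=> /andP[/asboolP ci ndi]; have [rs sd _] := sP i ci.
  apply: unfinished_credit => //.
  - by move=> j rj; move: (rel0 j) rj => /=; rewrite /th; lra.
  - apply: contraNN ndi => fi; apply/asboolP; by exists (remaining s0).
  - by have := rel0 i; rewrite /=; lra.
have h1 : 1 < h%:R :> R by rewrite ltr1n.
have Cpos : 0 < (capacity I)%:R :> R by rewrite ltr0n.
(* Lengths are at least 1, so the jobs counted here all occupy the allocation [a] at time [t].
   Feasibility says nothing for negative [t], where no job is counted. *)
have pack t : \sum_(j | P j && (s j <= t < s j + 1)) (demand (th j))%:R
    <= (capacity I)%:R :> R.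
  have [t0|t0] := ltP t 0.
    rewrite big_pred0 // => j; apply/negP => /and3P[/andP[/asboolP cj _] st _].
    have [rs _ _] := sP j cj; have := rel0 j; lra.
  rewrite -natr_sum ler_nat; apply: leq_trans (fa t t0).
  rewrite big_mkcond /=; apply: leq_sum => j _.
  case: ifP => // /and3P[/andP[/asboolP cj _] st tj]; have [_ _ ->] := sP j cj => //.
  by rewrite st /=; apply: lt_le_trans tj _; rewrite lerD2l.
(* Each job charges its credit to the completions; after exchanging the sums, [discounted_packing]
   bounds what each completion is charged. *)
have key : X * floor_load I h * (1 - d) <= chi * (capacity I)%:R * W.
  apply: (@le_trans _ _ ((\sum_(p <- ps) p.2 * chi *
      (\sum_(i | P i && (s i <= p.1)) (demand (th i))%:R * disc chi kappa%:R (s i - p.1)))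
      * (1 - d))).
    rewrite ler_wpM2r ?subr_ge0 ?(ltW d1) //.
    rewrite /X mulr_suml.
    apply: (@le_trans _ _ (\sum_(i | P i) (demand (th i))%:R * credit chi kappa%:R ps (s i))).
      apply: ler_sum => i Pi.
      have -> : value (jobs i) = (demand (th i))%:R * job_density i.
        by rewrite mulrC /job_density divfK // pnatr_eq0 -lt0n.
      by rewrite -mulrA ler_wpM2l // unfin.
    under eq_bigr do rewrite /credit mulr_sumr.
    rewrite (exchange_big_dep predT) //=.
    under [leRHS]eq_bigr do rewrite mulr_sumr.
    rewrite le_eqVlt; apply/orP; left; apply/eqP.
    by apply: eq_bigr => p _; apply: eq_bigr => i _; ring.
  have Wps : \sum_(p <- ps) p.2 <= W.
    have := @sum_completions I (remaining s0) s0 _.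
    rewrite big_set0 addr0 => ->; last first.
      by move=> s'; exact: finished_step.
    apply: ler_sum_sub => // j jf; apply/asboolP; by exists (remaining s0).
  apply: (@le_trans _ _ (\sum_(p <- ps) p.2 * chi * (capacity I)%:R)).
    rewrite mulr_suml big_seq [leRHS]big_seq; apply: ler_sum => p pps.
    rewrite -[leLHS]mulrA ler_wpM2l //.
      rewrite mulr_ge0 ?(ltW (lt_trans ltr01 chi_gt1)) //.
      by apply: completion_ge0 pps => i; exact: v0.
    apply: discounted_packing => // j /andP[/asboolP cj _].
    by have [rs _ _] := sP j cj; apply: le_trans rs.
  rewrite -!mulr_suml -mulrA mulrC ler_wpM2l //.
  by rewrite mulr_ge0 ?(ltW (lt_trans ltr01 chi_gt1)) // ltW.
have D0 : 0 < floor_load I h * (1 - d).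
  rewrite /floor_load !mulr_gt0 ?invr_gt0 ?subr_gt0 //; lra.
rewrite -(ler_pM2r D0) mulrA (le_trans key) //.
rewrite le_eqVlt; apply/orP; left; apply/eqP; rewrite /floor_load.
by field; rewrite !subr_eq0 !gt_eqF // (lt_trans ltr01).
Qed.

End UpperBound.

(** * The adversary *)

Lemma disc_lt {R : realType} (chi kappa x y : R) : 1 < chi -> 0 < kappa ->
  x < y -> disc chi kappa x < disc chi kappa y.
Proof. by move=> chi1 k0 xy; rewrite /disc (gt1_ltr_powR chi1) ltr_pM2r ?invr_gt0. Qed.

Lemma schedule_le_OPT {R : realType} (I : instance R) (S : pred 'I_(njobs I))
    (sigma : 'I_(njobs I) -> R) :
  (forall i : 'I_(njobs I), 0 <= value (jobs i)) ->
  (forall i, S i -> release (jobs i) <= sigma i /\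
                    sigma i + len (jobs i) <= deadline (jobs i)) ->
  (forall t, \sum_(i | S i && (sigma i <= t < sigma i + len (jobs i))%R)
               demand (jobs i) <= capacity I)%N ->
  \sum_(i | S i) value (jobs i) <= OPT I.
Proof.
move=> v0 SP cap.
pose a : allocation I := fun i t =>
  if S i && (sigma i <= t < sigma i + len (jobs i)) then demand (jobs i) else 0%N.
apply: (@le_trans _ _ (social_welfare a)).
  apply: ler_sum_sub => // i Si; apply/asboolP; exists (sigma i).
  have [rs sd] := SP i Si; split => // t ti.
  by rewrite /a Si ti.
apply: (OPT_attained I).2 => t _.
by rewrite /a -big_mkcond.
Qed.

Lemma val_ord_max m (k : 'I_m.+1) : (m <= k)%N -> val k = m.
Proof. by move=> mk; apply/eqP; rewrite eqn_leq mk -ltnS ltn_ord. Qed.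

Section Adversary.
Context {R : realType}.
Variables (h kappa n M : nat) (chi eps : R) (tie : tie_rule R).

Notation g := (disc chi kappa%:R).

(** The tag [inl k] is the [k]-th wave of carriers and [inr m] the group of unit jobs released at
    time [m.+1]; each consists of [h] jobs. *)
Definition tag : finType := (('I_(2 * M).+1 + 'I_(M + kappa)) * 'I_h)%type.

(** The spacing 1/2 is less than any job length, so a wave is preempted before it can complete, even
    for [kappa = 1]. *)
Definition wave_time (k : nat) : R := eps + k%:R / 2.

Definition demand_of (a : tag) : nat :=
  match a with (inl _, x) => if val x == 0%N then 1%N else n | (inr _, _) => n end.

(* Slot 0 of a wave is slightly lighter than its other slots, so that an old
   wave is blocked by one of its jobs of demand [n] before its job of demand 1
   could be kept beside the new wave.  The jobs [inr m] are too light to be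
   preferred to any wave. *)
Definition density_of (a : tag) : R :=
  match a with
  | (inl k, x) => g (wave_time k + 2 * k%:R * eps - (val x == 0%N)%:R * eps)
  | (inr m, _) => g (m.+1%:R - 2 * eps)
  end.

(** Only the last wave has slack: its deadline lets it run after all unit jobs. Every other job is
    lost unless it starts at its release and is never interrupted. *)
Definition adversary_job (a : tag) : job R :=
  let v := density_of a * (demand_of a)%:R in
  match a with
  | (inl k, _) =>
    Job (wave_time k)
        (if (k < 2 * M)%N then wave_time k + kappa%:R else (M + 2 * kappa).+1%:R)
        (demand_of a) kappa%:R v
  | (inr m, _) => Job m.+1%:R m.+2%:R (demand_of a) 1 v
  end.

Definition tag_of (i : 'I_#|tag|) : tag := enum_val i.

Definition adversary : instance R :=
  Instance (h * n) (fun i => adversary_job (tag_of i)).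

Definition last_wave (a : tag) : bool :=
  if a.1 is inl k then (2 * M <= k)%N else false.

Definition wave_end (k : nat) : R :=
  if (k < 2 * M)%N then wave_time k.+1 else wave_time k + kappa%:R.

Definition current (t : R) (a : tag) : bool :=
  if a.1 is inl k then wave_time k <= t < wave_end k else false.

Hypothesis h_ge2 : (2 <= h)%N.
Hypothesis kappa_ge1 : (1 <= kappa)%N.
Hypothesis n_ge1 : (1 <= n)%N.
Hypothesis chi_gt1 : 1 < chi.
Hypothesis eps_gt0 : 0 < eps.
Hypothesis eps_lt : eps < 1 / 2.
Hypothesis tie_total : total tie.
Hypothesis tie_trans : transitive tie.

Notation th := (@jobs R adversary).
Notation act := (@act R (fun x => chi `^ x) tie adversary).
Notation step := (@step R (fun x => chi `^ x) tie adversary).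
Notation prio := (@run_priority R chi adversary).
Notation density := (@job_density R adversary).

Let kappa_gt0 : 0 < kappa%:R :> R. Proof. by rewrite ltr0n. Qed.
Let kappa_ge1R : 1 <= kappa%:R :> R. Proof. by rewrite ler1n. Qed.

Lemma demand_of_bounds a : (0 < demand_of a <= n)%N.
Proof.
case: a => [[k|m] x] /=; last by rewrite n_ge1 leqnn.
by case: ifP => _; rewrite ?n_ge1 ?leqnn.
Qed.

Lemma density_of_gt0 a : 0 < density_of a.
Proof. by case: a => [[k|m] x] /=; exact: disc_gt0. Qed.

Lemma demandE i : demand (th i) = demand_of (tag_of i).
Proof. by rewrite /=; case: (tag_of i) => [[k|m] x]. Qed.

Lemma valueE i : value (th i) = density_of (tag_of i) * (demand_of (tag_of i))%:R.
Proof. by rewrite /=; case: (tag_of i) => [[k|m] x]. Qed.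

Lemma densityE i : density i = density_of (tag_of i).
Proof.
rewrite /job_density valueE demandE mulfK // pnatr_eq0 -lt0n.
by case/andP: (demand_of_bounds (tag_of i)).
Qed.

Lemma wave_time_le k l : (k <= l)%N -> wave_time k <= wave_time l.
Proof. by rewrite /wave_time => kl; rewrite lerD2l ler_pM2r // ler_nat. Qed.

Lemma wave_time_last : wave_time (2 * M) = M%:R + eps.
Proof. by rewrite /wave_time natrM; field. Qed.

Lemma wave_timeS k : wave_time k.+1 = wave_time k + 1 / 2.
Proof. by rewrite /wave_time -natr1; field. Qed.

Lemma adversary_valid i : valid_job kappa (th i).
Proof.
have [d0 _] := andP (demand_of_bounds (tag_of i)).
have v0 : 0 < density_of (tag_of i) * (demand_of (tag_of i))%:R.
  by rewrite mulr_gt0 ?ltr0n // density_of_gt0.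
move: d0 v0 => /=; case: (tag_of i) => [[k|m] x] d0 v0; split => //=.
- by rewrite addr_ge0 ?(ltW eps_gt0) // divr_ge0.
- by rewrite lexx andbT.
- by rewrite lexx.
Qed.

Lemma adversary_class : instance_class h kappa adversary.
Proof.
split; first exact: adversary_valid.
rewrite /= leq_mul2l; apply/orP; right; apply/bigmax_leqP => i _.
by rewrite demandE; have /andP[] := demand_of_bounds (tag_of i).
Qed.

Lemma tag_sum {V : Type} {idx : V} (op : Monoid.com_law idx) (P : pred tag) (F : tag -> V) :
  \big[op/idx]_(i < #|tag| | P (tag_of i)) F (tag_of i) = \big[op/idx]_(a | P a) F a.
Proof.
rewrite [RHS](reindex (@enum_val tag predT)) //.
by exists enum_rank => a _; rewrite ?enum_valK ?enum_rankK.
Qed.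

Lemma group_sum {V : Type} {idx : V} (op : Monoid.com_law idx) (P : pred tag) (F : tag -> V) p :
  (forall a, P a = (a.1 == p)) ->
  \big[op/idx]_(a | P a) F a = \big[op/idx]_(x < h) F (p, x).
Proof.
move=> PE; rewrite (reindex_onto (fun x : 'I_h => (p, x)) snd) /=.
  by apply: eq_bigl => x; rewrite PE /= !eqxx.
by case=> q x; rewrite PE /= => /eqP ->.
Qed.

Lemma wave_demand : (\sum_(x < h) (if val x == 0 then 1 else n) = 1 + (h - 1) * n)%N.
Proof.
case: h h_ge2 => // h' _; rewrite big_ord_recl /=; congr addn.
rewrite (eq_bigr (fun=> n)) // sum_nat_const card_ord; lia.
Qed.

Lemma wave_capacity :
  (1 + (h - 1) * n <= h * n)%N /\ (h * n < (1 + (h - 1) * n) + n)%N.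
Proof.
by case: h h_ge2 => // h' _; rewrite subSS subn0 mulSn; split; lia.
Qed.

(** Waves have length [kappa], so their priorities grow exactly like [g]; the factor
    [g (wave_time k)] in the density cancels the starting time. *)
Lemma run_prio (i : 'I_(njobs adversary)) k x t : tag_of i = (inl k, x) ->
  prio (wave_time k) t i = g (t + 2 * k%:R * eps - (val x == 0%N)%:R * eps).
Proof.
move=> ti; rewrite /run_priority densityE ti /= ti /=.
rewrite -[chi `^ _]/(g (t - wave_time k)) -discD //; congr (disc _ _ _); lra.
Qed.


Definition horizon : R := wave_time (2 * M) + kappa%:R.

Lemma current_wave t : wave_time 0 <= t < horizon ->
  exists k : 'I_(2 * M).+1, forall a, current t a = (a.1 == inl k).
Proof.
move=> /andP[t0 tT].
case: (@arg_maxnP _ (ord0 : 'I_(2 * M).+1) (fun k => wave_time k <= t) val t0) => k kt kmax.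
exists k => -[[l|m] x] //=; rewrite /current /=.
have -> : (inl l == inl k :> 'I_(2 * M).+1 + 'I_(M + kappa)) = (l == k) by [].
apply/andP/eqP => [[lt tl]|->].
  have : (l <= k)%N by exact: kmax.
  rewrite leq_eqVlt => /orP[/eqP/val_inj//|lk].
  have l2 : (l < 2 * M)%N by apply: leq_trans lk _; rewrite -ltnS.
  by move: tl; rewrite /wave_end l2 ltNge (le_trans (wave_time_le lk) kt).
split => //; rewrite /wave_end; case: ltnP => k2.
  rewrite ltNge; apply/negP => kt'.
  have : (k.+1 <= k)%N := kmax (Ordinal (k2 : (k.+1 < (2 * M).+1)%N)) kt'.
  by rewrite ltnn.
have -> // : val k = (2 * M)%N by exact: val_ord_max.
Qed.

Lemma wave_time_ltT (k : 'I_(2 * M).+1) : wave_time k < horizon.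
Proof.
have : wave_time k <= wave_time (2 * M) by rewrite wave_time_le // -ltnS.
by have := kappa_gt0; rewrite /horizon; lra.
Qed.

Lemma release_ltT i : release (th i) < horizon.
Proof.
rewrite /=; case: (tag_of i) => [[k|m] x] /=; first exact: wave_time_ltT.
rewrite /horizon wave_time_last.
have : m.+1%:R <= (M + kappa)%:R :> R by rewrite ler_nat.
by have := eps_gt0; rewrite natrD; lra.
Qed.

Lemma release_ge i : wave_time 0 <= release (th i).
Proof.
rewrite /=; case: (tag_of i) => [[k|m] x] /=; first exact: wave_time_le.
have : 1 <= m.+1%:R :> R by rewrite ler1n.
by have := eps_lt; rewrite /wave_time mul0r; lra.
Qed.

Lemma tag_of_onto a : exists i, tag_of i = a.
Proof. by exists (enum_rank a); rewrite /tag_of enum_rankK. Qed.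

Lemma deadline_early i : ~~ last_wave (tag_of i) ->
  deadline (th i) = release (th i) + len (th i).
Proof.
rewrite /last_wave /=; case: (tag_of i) => [[k|m] x] /=.
  by rewrite -ltnNge => ->.
by rewrite -natr1.
Qed.

Lemma deadline_ge i : release (th i) + len (th i) <= deadline (th i).
Proof.
rewrite /=; case: (tag_of i) => [[k|m] x] /=; last by rewrite natr1.
case: ifP => // _; have := wave_time_ltT k; rewrite /horizon wave_time_last.
by rewrite -[(_ + _).+1%:R]natr1 natrD natrM; have := eps_lt; lra.
Qed.

(** The state is described exactly up to [horizon], the end of the last wave. Afterwards the welfare
    bound only needs that no job outside the last wave completes. *)
Definition tracked (s : state R (njobs adversary)) : Prop :=
  if now s < horizon then
    finished s = finset.set0 /\
    forall i, start s i = if current (now s) (tag_of i)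
                          then Some (release (th i)) else None
  else forall i, (i \in finished s) || start s i -> last_wave (tag_of i).

Lemma early_not_candidate (s : state R (njobs adversary)) t i :
  start s i = None -> release (th i) < t -> ~~ last_wave (tag_of i) ->
  ~~ candidate s t i.
Proof.
move=> si rt ni; rewrite /candidate deadline_early // /run_start /run si /=.
by apply/negP => /and3P[_ + _]; rewrite lerD2r leNgt rt.
Qed.

Let half i : (2 * demand (th i) <= capacity adversary)%N.
Proof.
rewrite demandE /=; have /andP[_ dn] := demand_of_bounds (tag_of i).
by rewrite leq_mul.
Qed.

Let dem0 i : (0 < demand (th i))%N.
Proof. by have [] := adversary_valid i. Qed.

Let len0 i : 0 < len (th i).
Proof. by have [_ _ /andP[l1 _] _] := adversary_valid i; apply: lt_le_trans l1. Qed.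

Let value0 i : 0 <= value (th i).
Proof. by have [_ _ _ /ltW] := adversary_valid i. Qed.

Let act_specA := act_spec chi tie_total tie_trans dem0 half len0 value0.

(** Before [horizon] the current wave outranks all other candidates, fits, and leaves less than [n]
    free instances. From [horizon] on, jobs outside the last wave have missed their only starting
    time. *)
Lemma tracked_act (s : state R (njobs adversary)) t :
  running_ok s -> next_critical s t -> tracked s -> tracked (act t s).
Proof.
move=> ok [tc tmin] trk; have nt := critical_gt ok tc.
have release_before i : t <= release (th i) \/ release (th i) <= now s.
  case: (ltP (now s) (release (th i))) => rn; last by right.
  by left; apply: tmin; apply/critical_timesP; left; exists i.
have running_before i u : start s i = Some u -> t <= u + len (th i).
  by move=> si; apply: tmin; apply/critical_timesP; right; exists i, u.
have [finE startE cap rej] := act_specA s t.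
move: (act t s) (erefl : now (act t s) = t) finE startE cap rej => s' ns' finE startE cap rej.
rewrite /tracked ns'; move: trk; rewrite /tracked.
case: (ltP (now s) horizon) => [nT|Tn]; last first.
  move=> trk; rewrite ltNge (le_trans Tn (ltW nt)) /= => i.
  apply: contraTT => ni.
  have [fi si] : i \notin finished s /\ start s i = None.
    have : ~~ ((i \in finished s) || start s i) by apply: contra ni; apply: trk.
    by case: (start s i) => [u|]; rewrite ?orbT // orbF.
  rewrite finE !inE si (negbTE fi) /=.
  have [-> //|[_ ci]] := startE i.
  have /negP[//] : ~~ candidate s t i; apply: early_not_candidate => //.
  exact: lt_trans (release_ltT i) (le_lt_trans Tn nt).
move=> [fin0 sE].
have wave_before (k : 'I_(2 * M).+1) : t <= wave_time k \/ wave_time k <= now s.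
  have [i ti] := tag_of_onto (inl k, Ordinal (ltnW h_ge2)).
  by have := release_before i; rewrite /= ti.
have wave_early (k : 'I_(2 * M).+1) : (k < 2 * M)%N -> now s < wave_end k -> t <= wave_time k.+1.
  move=> k2; rewrite /wave_end k2 => nk.
  have [//|] := wave_before (Ordinal (k2 : (k.+1 < (2 * M).+1)%N)).
  by move=> /= kn; move: nk; rewrite ltNge kn.
(* The step cannot jump over [horizon]: the last wave is either still to be released, or running and
   due to end at [horizon]. *)
have tT : t <= horizon.
  have [//|lastn] := wave_before ord_max.
    by move/le_trans; apply; rewrite ltW // wave_time_ltT.
  have [i ti] := tag_of_onto (inl ord_max, Ordinal (ltnW h_ge2)).
  have si : start s i = Some (wave_time (2 * M)).
    have : current (now s) (tag_of i).
      by rewrite /current ti /= lastn /wave_end ltnn.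
    by rewrite sE => ->; rewrite /= ti.
  by have := running_before _ _ si; rewrite /= ti.
(* An earlier wave is superseded after 1/2, before its length [kappa] has elapsed. *)
have endedP i : i \in ended s t -> last_wave (tag_of i) /\ t = horizon.
  rewrite inE sE; case: ifP => //; rewrite /current /last_wave /=.
  case: (tag_of i) => [[k|m] x] //= /andP[kn nk] /eqP tE.
  case: (ltnP k (2 * M)) => k2.
    by have := wave_early k k2 nk; rewrite wave_timeS -tE; have := kappa_ge1R; lra.
  have kE : val k = (2 * M)%N by exact: val_ord_max.
  by split => //; rewrite -tE kE.
case: (ltgtP t horizon) tT => // [tT _|tE _]; last first.
  move=> i; apply: contraTT => ni.
  have ei : i \notin ended s t by apply: contra ni => /endedP[].
  rewrite finE fin0 !inE /=; move: ei; rewrite inE => /negbTE ->.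
  have si : start s i = None.
    rewrite sE; case: ifP => //; move: ni; rewrite /current /last_wave.
    case: (tag_of i) => [[k|m] x] //=; rewrite -ltnNge => k2 /andP[kn nk].
    have := wave_early k k2 nk; rewrite tE.
    by rewrite leNgt (wave_time_ltT (Ordinal (k2 : (k.+1 < (2 * M).+1)%N))).
  have [-> //|[_ ci]] := startE i.
  have /negP[//] : ~~ candidate s t i; apply: early_not_candidate => //.
  by rewrite tE release_ltT.
have ended0 : ended s t = finset.set0.
  apply/setP => i; rewrite [RHS]inE; apply/negP => /endedP[_ tE].
  by move: tT; rewrite tE ltxx.
split; first by rewrite finE fin0 ended0 finset.setU0.
have [k kE] : exists k : 'I_(2 * M).+1, forall a, current t a = (a.1 == inl k).
  apply: current_wave; rewrite tT andbT.
  case/critical_timesP: tc => [[i _ ->]|[i [u [si ->]]]]; first exact: release_ge.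
  have [ru _ _ _ _] := ok _ _ si.
  by apply: le_trans (release_ge i) _; apply: le_trans ru _; rewrite lerDl ltW.
have run_current i : current (now s) (tag_of i) || current t (tag_of i) ->
    candidate s t i /\ run_start s t i = release (th i).
  move=> cur; have rt : release (th i) <= t.
    move: cur; rewrite /current /=; case: (tag_of i) => [[l|m] x] //=.
    by case/orP => /andP[] // ln _; apply: le_trans ln (ltW nt).
  have rsE : run_start s t i = release (th i).
    have : i \notin ended s t by rewrite ended0 inE.
    rewrite inE /run_start /run.
    rewrite sE; case: ifP => [_ /negbTE -> //|ncn _] /=.
    apply/le_anti; rewrite rt andbT.
    move: cur; rewrite ncn /= => ct.
    have [//|rn] := release_before i.
    move: ncn ct rn; rewrite /current /=; case: (tag_of i) => [[l|m] x] //=.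
    by move=> + /andP[_ tl] ln; rewrite ln (lt_trans nt tl).
  by split => //; rewrite /candidate rt rsE deadline_ge fin0 ended0 finset.setU0 inE.
(* The competitors of the current wave are unit jobs released at [t] and the wave superseded at
   [t]. *)
have noncurrent w : candidate s t w -> ~~ current t (tag_of w) ->
    (exists m x, tag_of w = (inr m, x) /\ prio (run_start s t w) t w = g (t - 2 * eps)) \/
    (exists l x, [/\ tag_of w = (inl l, x), l.+1 = k & current (now s) (tag_of w)]).
  move=> cw ncw; have [cn|ncn] := boolP (current (now s) (tag_of w)).
    right; case tw: (tag_of w) cn ncw => [[l|m] x] // cn.
    have /andP[ln nl] : wave_time l <= now s < wave_end l by [].
    rewrite /current /= (le_trans ln (ltW nt)) /= -leNgt => et.
    exists l, x; split => //.
    have l2 : (l < 2 * M)%N.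
      rewrite ltnNge; apply/negP => l2.
      have lE : val l = (2 * M)%N by exact: val_ord_max.
      by move: et; rewrite /wave_end ltnNge l2 /= lE leNgt tT.
    have tE : t = wave_time l.+1.
      by apply/le_anti; rewrite wave_early //; move: et; rewrite /wave_end l2.
    have := kE (inl (Ordinal (l2 : (l.+1 < (2 * M).+1)%N)), x).
    rewrite /current /= {1}tE lexx tE /= => /esym.
    have -> : wave_time l.+1 < wave_end l.+1.
      rewrite /wave_end; case: ifP => _; last by rewrite ltrDl.
      by rewrite [ltRHS]wave_timeS; lra.
    by move=> /eqP[<-].
  have sN : start s w = None by rewrite sE (negbTE ncn).
  have rsE : run_start s t w = t by rewrite /run_start /run sN.
  have [lw|nlw] := boolP (last_wave (tag_of w)).
    move: lw ncw cw; rewrite /last_wave /current /candidate /=.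
    case tw: (tag_of w) => [[l|m] x] //= l2.
    have lE : val l = (2 * M)%N by exact: val_ord_max.
    by rewrite /wave_end ltnNge l2 /= lE tT andbT => /negbTE ->.
  have rt : release (th w) = t.
    apply/le_anti; have [-> rt] : release (th w) <= t /\ t <= release (th w); last exact: rt.
      move: cw; rewrite /candidate rsE deadline_early // => /and3P[-> + _].
      by rewrite lerD2r.
  move: rt ncw; rewrite rsE prio_start densityE /current /= => <-.
  case tw: (tag_of w) => [[l|m] x] /=; last by left; exists m, x.
  rewrite lexx /wave_end /=; case: ifP => _; last by rewrite ltrDl kappa_gt0.
  by rewrite wave_timeS ltrDl divr_gt0.
(* The priority of slot 0, the lowest in the current wave. *)
pose top := g (t + 2 * k%:R * eps - eps).
have current_prio i : current t (tag_of i) -> top <= prio (run_start s t i) t i.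
  move=> ci; have [_ ->] := run_current i (introT orP (or_intror ci)).
  move: ci; rewrite kE; case ti: (tag_of i) => [p x] /= /eqP pE; rewrite pE in ti.
  have -> : release (th i) = wave_time k by rewrite /= ti.
  rewrite (run_prio _ ti) /top; case: (val x == 0%N); rewrite ?mul1r ?mul0r //.
  by rewrite ltW // disc_lt //; have := eps_gt0; lra.
have noncurrent_prio w : candidate s t w -> ~~ current t (tag_of w) ->
    prio (run_start s t w) t w < top.
  move=> cw ncw; have [[m [x [_ ->]]]|[l [x [tw lk cn]]]] := noncurrent w cw ncw.
    apply: disc_lt => //; have : 0 <= k%:R * eps by rewrite mulr_ge0 // ltW.
    by have := eps_gt0; lra.
  have [_ ->] := run_current w (introT orP (or_introl cn)).
  have -> : release (th w) = wave_time l by rewrite /= tw.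
  rewrite (run_prio _ tw); apply: disc_lt => //.
  rewrite -lk -[l.+1%:R]natr1.
  have : 0 <= (val x == 0%N)%:R * eps by rewrite mulr_ge0 // ltW.
  by have := eps_gt0; lra.
have current_demand : (\sum_(j | current t (tag_of j)) demand (th j) = 1 + (h - 1) * n)%N.
  rewrite (eq_bigr (fun j => demand_of (tag_of j))) => [|j _]; last exact: demandE.
  by rewrite tag_sum (group_sum _ _ kE) /= wave_demand.
have capE : capacity adversary = (h * n)%N by [].
have startedP j : start s' j -> candidate s t j by have [->|[]] := startE j.
(* If [i] were rejected, the blocked job [r] and all started jobs would have at least its priority,
   hence be current; but the whole wave fits. *)
have started i : current t (tag_of i) -> start s' i.
  move=> ci; case si: (start s' i) => [//|]; exfalso.
  have [cdi _] := run_current i (introT orP (or_intror ci)).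
  have [r [cr sr ir gt le]] := rej i cdi si.
  have rcur : current t (tag_of r).
    apply/negPn/negP => nr; have := noncurrent_prio r cr nr.
    by rewrite ltNge (le_trans (current_prio i ci) ir).
  move: gt; rewrite capE ltnNge => /negP; apply.
  apply: (@leq_trans (1 + (h - 1) * n)); last by case: wave_capacity.
  rewrite -current_demand (bigD1 r rcur) (addnC _ (demand (th r))) leq_add2l.
  apply: leq_sum_sub => j sj.
  apply/andP; split; last by apply: contraTneq sj => ->; rewrite sr.
  apply/negPn/negP => nj; have := noncurrent_prio j (startedP j sj) nj.
  by rewrite ltNge (le_trans (current_prio r rcur) (le j sj)).
have overfull w : start s' w -> ~~ current t (tag_of w) -> demand_of (tag_of w) <> n.
  move=> sw ncw dw; move: cap; rewrite capE leqNgt => /negP; apply.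
  rewrite (bigD1 w sw) demandE dw.
  have : (1 + (h - 1) * n <= \sum_(j | start s' j && (j != w)) demand (th j))%N.
    rewrite -current_demand; apply: leq_sum_sub => j cj; rewrite started //=.
    by apply: contraNneq ncw => <-.
  move=> others; apply: leq_trans wave_capacity.2 _.
  by rewrite (addnC _ n) leq_add2l.
have only_current w : start s' w -> current t (tag_of w).
  move=> sw; apply/negPn/negP => ncw.
  have [[m [x [tw _]]]|[l [x [tw lk cn]]]] := noncurrent w (startedP w sw) ncw.
    by have := overfull w sw ncw; rewrite tw.
  have := overfull w sw ncw; rewrite tw /=; case: eqP => // x0 _.
  (* The remaining suspect is slot 0 of the superseded wave. Its companion [w'] in slot 1 has demand
     [n], so it is rejected; the blocked job then ranks no lower than [w'] and no higher than [w],
     although [w'] is strictly above [w]. *)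
  have [w' tw'] := tag_of_onto (inl l, Ordinal h_ge2).
  have cn' : current (now s) (tag_of w') by move: cn; rewrite tw tw'.
  have [cw' rw'] := run_current w' (introT orP (or_introl cn')).
  have [_ rw] := run_current w (introT orP (or_introl cn)).
  have ncw' : ~~ current t (tag_of w') by move: ncw; rewrite !kE tw tw'.
  case sw': (start s' w') => [u|].
    by have := overfull w'; rewrite sw' ncw' tw'; apply.
  have [r [_ _ wr _ le]] := rej w' cw' sw'.
  have := le_trans wr (le w sw); rewrite rw rw'.
  have -> : release (th w) = wave_time l by rewrite /= tw.
  have -> : release (th w') = wave_time l by rewrite /= tw'.
  rewrite (run_prio _ tw) (run_prio _ tw') leNgt => /negP; apply.
  have -> : val x == 0%N by apply/eqP.
  by apply: disc_lt => //=; have := eps_gt0; lra.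
move=> i; case: ifP => ci; last first.
  by case si: (start s' i) => [u|] //; have := only_current i; rewrite si ci => /(_ isT).
have [_ rE] := run_current i (introT orP (or_intror ci)).
by have := started i ci; have [->//|[-> _] _] := startE i; rewrite rE.
Qed.


Lemma tracked_state k :
  running_ok (gammaG_state (fun x => chi `^ x) tie adversary k) /\
  tracked (gammaG_state (fun x => chi `^ x) tie adversary k).
Proof.
rewrite /gammaG_state; elim: k => [|k [ok trk]] /=.
  split => //; rewrite /tracked /=; case: ifP => _; last by move=> i; rewrite inE.
  split => // i.
  rewrite /current /=; case: (tag_of i) => [[l|m] x] //=.
  have : wave_time 0 <= wave_time l by exact: wave_time_le.
  rewrite {1}/wave_time mul0r addr0 => el.
  suff -> : (wave_time l <= -1) = false by [].
  by apply/negbTE; rewrite -ltNge; have := eps_gt0; lra.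
have [[_ ->]//|[t nxt ->]] := step_cases chi tie (iter k step (init R (njobs adversary))).
by split; [exact: running_ok_act | exact: tracked_act].
Qed.

Lemma adversary_welfare :
  gammaG_welfare (fun x => chi `^ x) tie adversary
    <= \sum_(i | last_wave (tag_of i)) value (th i).
Proof.
apply: ler_sum_sub => // i /asboolP[k ik].
have [_] := tracked_state k; rewrite /tracked; case: ifP => _.
  by move=> [f0 _]; move: ik; rewrite f0 inE.
by move=> /(_ i); rewrite ik; apply.
Qed.

Lemma last_wave_value :
  \sum_(i | last_wave (tag_of i)) value (th i)
    <= (1 + (h - 1) * n)%:R * g (M%:R + eps + 4 * M%:R * eps).
Proof.
rewrite -wave_demand natr_sum mulr_suml.
rewrite (eq_bigr (fun i => density_of (tag_of i) * (demand_of (tag_of i))%:R)); last first.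
  by move=> i _; exact: valueE.
rewrite (tag_sum _ _ (fun a => density_of a * (demand_of a)%:R)).
rewrite (@group_sum _ _ _ _ _ (inl ord_max)); last first.
  move=> [[k|m] x] //=; rewrite /last_wave /=; apply/idP/eqP => [k2|[->] //].
  by congr inl; apply: val_inj; rewrite (val_ord_max k2).
apply: ler_sum => x _; rewrite mulrC /= ler_wpM2l //.
rewrite -/(wave_time _) wave_time_last natrM.
case: (val x == 0%N); rewrite ?mul1r ?mul0r.
  by rewrite ltW // disc_lt //; have := eps_gt0; lra.
by rewrite le_eqVlt; apply/orP; left; apply/eqP; congr (disc _ _ _); lra.
Qed.

(** Each group of unit jobs fills the capacity for one unit from its release; the last wave starts
    at [(M + kappa).+1], when the last group ends. *)
Lemma adversary_OPT :
  \sum_(i | last_wave (tag_of i)) value (th i)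
   + (h * n)%:R * (\sum_(m < M + kappa) g (m.+1%:R - 2 * eps)) <= OPT adversary.
Proof.
pose small (a : tag) := if a.1 is inr _ then true else false.
pose S (a : tag) := last_wave a || small a.
pose sigma (a : tag) : R := if a.1 is inr m then m.+1%:R else (M + kappa).+1%:R.
have lenE i : S (tag_of i) -> len (th i) = if small (tag_of i) then 1 else kappa%:R.
  by rewrite /S /small /=; case: (tag_of i) => [[k|m] x].
apply: (@le_trans _ _ (\sum_(i | S (tag_of i)) value (th i))).
  rewrite [leRHS](bigID (fun i => last_wave (tag_of i))); apply: lerD.
    rewrite le_eqVlt; apply/orP; left; apply/eqP/eq_bigl => i /=.
    by apply/esym/andb_idl => lw; rewrite /S lw.
  rewrite [leRHS](eq_bigl (fun i => small (tag_of i))); last first.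
    move=> i; rewrite /S /small /last_wave.
    by case: (tag_of i) => [[k|m] x] /=; rewrite ?orbF ?andbN.
  rewrite [leRHS](eq_bigr (fun i => density_of (tag_of i) * (demand_of (tag_of i))%:R)); last first.
    by move=> i _; exact: valueE.
  rewrite (tag_sum _ _ (fun a => density_of a * (demand_of a)%:R)).
  rewrite (reindex_onto (fun p : 'I_(M + kappa) * 'I_h => (inr p.1, p.2) : tag)
     (fun a => (if a.1 is inr m then m else Ordinal (ltn_addl M kappa_ge1), a.2))) /=; last first.
    by case=> [[k|m] x].
  rewrite [leRHS](eq_bigl predT); last by move=> [m x]; rewrite /= eqxx.
  rewrite -(pair_bigA _ (fun (m : 'I_(M + kappa)) (x : 'I_h) => g (m.+1%:R - 2 * eps) * n%:R)) /=.
  rewrite mulr_sumr; apply: ler_sum => m _.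
  rewrite sumr_const card_ord natrM -mulr_natl; lra.
apply: (@schedule_le_OPT _ adversary (fun i => S (tag_of i)) (fun i => sigma (tag_of i))) => //.
  move=> i Si; move: Si; rewrite /S /small /sigma /last_wave /=.
  case: (tag_of i) => [[k|m] x] /=; last by rewrite natr1 !lexx.
  rewrite orbF => k2; rewrite ltnNge k2 /=.
  have := wave_time_ltT k; rewrite /horizon wave_time_last => kT.
  have -> : (M + kappa).+1%:R = M%:R + kappa%:R + 1 :> R by rewrite -natr1 natrD.
  have -> : (M + 2 * kappa).+1%:R = M%:R + 2 * kappa%:R + 1 :> R.
    by rewrite -natr1 natrD natrM.
  by have := eps_lt; split; lra.
move=> t.
pose act_at i := S (tag_of i) && (sigma (tag_of i) <= t < sigma (tag_of i) + len (th i)).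
have [/existsP[i0 a0]|/existsPn none] := boolP [exists i, act_at i]; last first.
  by rewrite big_pred0 // => i; exact/negbTE/none.
(* Groups occupy disjoint time intervals, so it is enough that a single group fits. *)
have same i : act_at i -> (tag_of i).1 == (tag_of i0).1.
  move: a0; rewrite /act_at => /andP[S0 t0] /andP[Si ti]; move: t0 ti.
  rewrite !lenE //; move: S0 Si; rewrite /S /small /sigma /last_wave.
  case: (tag_of i0) => [[k0|m0] x0]; case: (tag_of i) => [[k|m] x] //=; rewrite ?orbF.
  - move=> k02 k2 _ _; apply/eqP; congr inl; apply: val_inj.
    by rewrite (val_ord_max k2) (val_ord_max k02).
  - move=> _ _ /andP[t0 _] /andP[_ t1].
    have : m.+2%:R <= (M + kappa).+1%:R :> R by rewrite ler_nat ltnS ltn_ord.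
    by rewrite -[m.+2%:R]natr1; lra.
  - move=> _ _ /andP[_ t0] /andP[t1 _].
    have : m0.+2%:R <= (M + kappa).+1%:R :> R by rewrite ler_nat ltnS ltn_ord.
    by rewrite -[m0.+2%:R]natr1; lra.
  move=> _ _ /andP[t0 t0'] /andP[t1 t1']; apply/eqP; congr inr; apply/val_inj/eqP => /=.
  have le1 : (m.+1 < m0.+2)%N by rewrite -(ltr_nat R) -[m0.+2%:R]natr1; lra.
  have le2 : (m0.+1 < m.+2)%N by rewrite -(ltr_nat R) -[m.+2%:R]natr1; lra.
  by rewrite eqn_leq; apply/andP; split.
apply: (@leq_trans (\sum_(i | (tag_of i).1 == (tag_of i0).1) demand (th i))%N).
  exact: leq_sum_sub.
rewrite (eq_bigr (fun i => demand_of (tag_of i))) => [|i _]; last exact: demandE.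
rewrite (tag_sum _ (fun a => a.1 == (tag_of i0).1)) (@group_sum _ _ _ _ _ (tag_of i0).1) //.
apply: (@leq_trans (\sum_(x < h) n)%N).
  by apply: leq_sum => x _; have /andP[] := demand_of_bounds ((tag_of i0).1, x).
by rewrite sum_nat_const card_ord.
Qed.

Lemma adversary_gap (y : R) : 0 <= y ->
  y * ((1 + (h - 1) * n)%:R * g (M%:R + eps + 4 * M%:R * eps))
    < (h * n)%:R * (\sum_(m < M + kappa) g (m.+1%:R - 2 * eps)) ->
  (y + 1) * gammaG_welfare (fun x => chi `^ x) tie adversary < OPT adversary.
Proof.
move=> y0 gap; apply: lt_le_trans adversary_OPT.
apply: (@le_lt_trans _ _ ((y + 1) * (\sum_(i | last_wave (tag_of i)) value (th i)))).
  by rewrite ler_wpM2l ?adversary_welfare // addr_ge0.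
rewrite mulrDl mul1r addrC ltrD2l; apply: le_lt_trans gap.
by rewrite ler_wpM2l // last_wave_value.
Qed.

End Adversary.

(** * Choice of the parameters *)

(** A linear lower bound for the exponential, which allows explicit parameters in place of
    limits. *)
Lemma disc_ge1D {R : realType} (chi kappa x : R) : 0 < chi ->
  1 + x * (ln chi / kappa) <= disc chi kappa x.
Proof.
move=> chi0; rewrite /disc /powR gt_eqF //.
have -> : x * (ln chi / kappa) = x / kappa * ln chi by ring.
exact: expR_ge1Dx.
Qed.

Lemma disc_sum {R : realType} (chi kappa x : R) N : 1 < chi ->
  (\sum_(m < N) disc chi kappa (m.+1%:R + x)) * (1 - disc chi kappa (-1))
    = (disc chi kappa N%:R - 1) * disc chi kappa x.
Proof.
move=> chi1; elim: N => [|N IH].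
  by rewrite big_ord0 mul0r {1}/disc mul0r powRr0 subrr mul0r.
rewrite big_ord_recr /= mulrDl IH.
have -> : disc chi kappa (N.+1%:R + x) * (1 - disc chi kappa (-1)) =
    disc chi kappa N.+1%:R * disc chi kappa x - disc chi kappa N%:R * disc chi kappa x.
  rewrite mulrBr mulr1 -!discD //; congr (_ - disc _ _ _).
  by rewrite -natr1; ring.
ring.
Qed.

Lemma ex_nat_mul_gt {R : archiRealFieldType} (a b : R) : 0 < b ->
  exists N : nat, a < N%:R * b.
Proof.
move=> b0; exists (Num.truncn (a / b)).+1.
by rewrite -ltr_pdivrMr // truncnS_gt.
Qed.

(** The choices are made in the order [M], [eps], [n]: many waves approach the full geometric
    series, a small [eps] makes the perturbed densities harmless, and a large [n] absorbs the extra
    1 in the demand of a wave. *)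
Lemma adversary_parameters {R : realType} (h kappa : nat) (chi y : R) :
  (2 <= h)%N -> (1 <= kappa)%N -> 1 < chi -> 0 <= y ->
  y < h%:R / (h%:R - 1) * (chi / (1 - disc chi kappa%:R (-1))) ->
  exists n M (eps : R), [/\ (1 <= n)%N, 0 < eps, eps < 1 / 2 &
    y * ((1 + (h - 1) * n)%:R * disc chi kappa%:R (M%:R + eps + 4 * M%:R * eps))
    < (h * n)%:R * (\sum_(m < M + kappa) disc chi kappa%:R (m.+1%:R - 2 * eps))].
Proof.
move=> h2 k1 chi1 y0; set g := disc chi kappa%:R; set K := _ * _ => yK.
have chi0 : 0 < chi by apply: lt_trans chi1.
have k0 : 0 < kappa%:R :> R by rewrite ltr0n.
have g0 x : 0 < g x by exact: disc_gt0.
have gD x z : g (x + z) = g x * g z by exact: discD.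
have gNK x : g (- x) * g x = 1 by exact: discNK.
pose L := ln chi / kappa%:R; have L0 : 0 < L by rewrite divr_gt0 // ln_gt0.
have gL x : 1 + x * L <= g x by exact: disc_ge1D.
have g1 : g 0 = 1 by rewrite /g /disc mul0r powRr0.
have d1 : 0 < 1 - g (-1).
  by rewrite subr_gt0 -[ltRHS]g1; apply: disc_lt => //; rewrite oppr_lt0 ltr01.
have hR : 2 <= h%:R :> R by rewrite ler_nat.
pose b := h%:R / (h%:R - 1) / (1 - g (-1)).
have b0 : 0 < b by rewrite !divr_gt0 //; lra.
have KE : K = b * chi by rewrite /K /b -/g mulrACA mulrA [RHS]mulrAC; ring.
have [M MP] : exists M : nat, y < b * (chi - g (- M%:R)).
  have [M bM] : exists M : nat, b < M%:R * ((K - y) * L).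
    by apply: ex_nat_mul_gt; rewrite mulr_gt0 // subr_gt0.
  exists M; rewrite mulrBr -KE ltrBrDr addrC -ltrBrDr.
  rewrite -(ltr_pM2r (g0 M%:R)) -mulrA gNK mulr1.
  have : (K - y) * (1 + M%:R * L) <= (K - y) * g M%:R by rewrite ler_wpM2l // subr_ge0 ltW.
  by move: yK bM; nra.
set K' := b * _ in MP.
have K'0 : 0 < K' by apply: le_lt_trans MP.
pose Q := K' * ((4 * M%:R + 3) * L).
have Q0 : 0 < Q.
  by apply: mulr_gt0 => //; apply: mulr_gt0.
have [eps [e0 e1 eQ]] : exists eps : R, [/\ 0 < eps, eps < 1 / 2 & Q * eps < K' - y].
  have D0 : 0 < 2 * Q + 4 * (K' - y) by lra.
  (* The summand [2 * Q] yields the bound on [Q * eps], and [4 * (K' - y)] the bound by 1/2. *)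
  exists ((K' - y) / (2 * Q + 4 * (K' - y))); split.
  - by rewrite divr_gt0 // subr_gt0.
  - by rewrite ltr_pdivrMr //; lra.
  - by rewrite mulrA ltr_pdivrMr //; nra.
(* The gap between the exponents [M + eps + 4 * M * eps] of the last wave and [M - 2 * eps] of the
   unit jobs. *)
pose x := (4 * M%:R + 3) * eps.
have y'K : y * g x < K'.
  rewrite -(ltr_pM2l (g0 (- x))) mulrCA gNK mulr1.
  have : K' * (1 + (- x) * L) <= K' * g (- x) by rewrite ler_pM2l.
  have -> : K' * (1 + (- x) * L) = K' - Q * eps by rewrite /Q /x; ring.
  lra.
have [n nP] : exists n : nat, y * g x < n%:R * ((h%:R - 1) * (K' - y * g x)).
  apply/ex_nat_mul_gt/mulr_gt0; [lra | by rewrite subr_gt0].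
have y'0 : 0 <= y * g x by rewrite mulr_ge0 // ltW.
exists n, M, eps; split => //.
  by case: n nP => //; rewrite mul0r ltNge y'0.
rewrite -(ltr_pM2r d1) -[ltRHS]mulrA /g disc_sum // -/g.
have -> : (M + kappa)%:R = M%:R + kappa%:R :> R by rewrite natrD.
have gk : g kappa%:R = chi.
  by rewrite /g /disc divff ?gt_eqF // powRr1 // ltW.
have -> : M%:R + eps + 4 * M%:R * eps = M%:R + x + - (2 * eps) by rewrite /x; ring.
rewrite !gD gk natrD !natrM natrB; last by apply: ltnW.
have -> : g M%:R * chi - 1 = g M%:R * (chi - g (- M%:R)).
  have gKN : g M%:R * g (- M%:R) = 1 by rewrite mulrC; exact: gNK.
  by rewrite mulrBr gKN.
have hK : h%:R * (chi - g (- M%:R)) = K' * (1 - g (-1)) * (h%:R - 1).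
  have dne : 1 - g (-1) != 0 by rewrite gt_eqF.
  have hne : h%:R - 1 != 0 :> R by rewrite gt_eqF //; lra.
  rewrite /K' /b; move: (chi - _) (1 - g (-1)) dne => z d dne.
  by field; rewrite dne hne.
have -> : h%:R * n%:R * (g M%:R * (chi - g (- M%:R)) * g (- (2 * eps))) =
  (h%:R * (chi - g (- M%:R))) * n%:R * (g M%:R * g (- (2 * eps))) by ring.
rewrite hK.
have -> : y * ((1 + (h%:R - 1) * n%:R) * (g M%:R * g x * g (- (2 * eps)))) * (1 - g (-1)) =
  (y * g x * (1 + (h%:R - 1) * n%:R)) * (1 - g (-1)) * (g M%:R * g (- (2 * eps))) by ring.
have -> : K' * (1 - g (-1)) * (h%:R - 1) * n%:R * (g M%:R * g (- (2 * eps))) =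
  (K' * (h%:R - 1) * n%:R) * (1 - g (-1)) * (g M%:R * g (- (2 * eps))) by ring.
rewrite (ltr_pM2r (mulr_gt0 (g0 _) (g0 _))) (ltr_pM2r d1).
lra.
Qed.

Theorem theorem3p1 (R : realType) (h kappa : nat) (chi : R)
    (tie : tie_rule R) :
  (2 <= h)%N -> (1 <= kappa)%N -> 1 < chi ->
  total tie -> transitive tie ->
  is_competitive_ratio
    (gammaG_welfare (fun delta => chi `^ delta) tie)
    (@instance_class R h kappa)
    (h%:R / (h%:R - 1) * (chi / (1 - chi `^ (- (kappa%:R)^-1))) + 1).
Proof.
move=> h2 k1 chi1 tie_total tie_trans; split.
  move=> [I cI]; apply/negP; rewrite -leNgt.
  exact: mechanism_upper_bound.
have -> : chi `^ (- kappa%:R^-1) = disc chi kappa%:R (-1) by rewrite /disc mulN1r.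
set K := _ * _ => c' c'K; apply.
(* The maximum with 0 covers [c' < 1], since [adversary_gap] requires a nonnegative factor. *)
pose y := Num.max (c' - 1) 0.
have y0 : 0 <= y by rewrite le_max lexx orbT.
have yK : y < K.
  rewrite gt_max ltrBlDr c'K /= mulr_gt0 // divr_gt0 //.
  - by rewrite ltr0n; apply: ltn_trans h2.
  - by rewrite subr_gt0 ltr1n.
  - exact: lt_trans chi1.
  rewrite subr_gt0 -[ltRHS](powRr0 chi) -(mul0r (kappa%:R^-1)).
  by apply: disc_lt => //; rewrite ?ltr0n //; lra.
have [n [M [eps [n1 e0 e1 gap]]]] := adversary_parameters h2 k1 chi1 y0 yK.
pose A := adversary h kappa n M chi eps.
have A_class : instance_class h kappa A by exact: adversary_class.
exists A => //.
apply: le_lt_trans (adversary_gap h2 k1 n1 chi1 e0 e1 tie_total tie_trans y0 gap).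
rewrite ler_wpM2r //; last by rewrite -lerBlDr le_max lexx.
by apply: sumr_ge0 => i _; have [_ _ _ /ltW] := A_class.1 i.
Qed.
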